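(* Let $\mathbb{K}$ be an algebraically closed field (of any characteristic), let $k\ge 1$, and let $f_1,\dots,f_m\in\mathbb{K}[x_1,\dots,x_k]$ be homogeneous polynomials of degrees $0<d_1\le\dots\le d_m$ (with $\deg f_i=d_i$) such that the variety $V(f_1,\dots,f_m)\subseteq\mathbb{P}^{k-1}(\mathbb{K})$ has dimension $0$. Then $$|V(f_1,\dots,f_m)|\ \le\ d_1\,d_{m-k+3}\,d_{m-k+4}\cdots d_m .$$ Moreover, if $f_1,\dots,f_s$ form a regular sequence, then $$|V(f_1,\dots,f_m)|\ \le\ d_1\cdots d_s\,d_{m-k+s+2}\cdots d_m .$$
   Context: $V(f_1,\dots,f_m)$ denotes the common zero locus of $f_1,\dots,f_m$ in $\mathbb{P}^{k-1}(\mathbb{K})$, and $|V(f_1,\dots,f_m)|$ is its number of points (as a set). Dimension is projective dimension: $\dim V(J)=\dim\mathbb{K}[x_1,\dots,x_k]/J-1$ (Krull dimension) for a homogeneous ideal $J$; in particular dimension $0$ means that the zero locus is nonempty and finite. In the products, $d_{a}\cdots d_m$ denotes $\prod_{i=a}^m d_i$, which is $1$ if $a=m+1$. *)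

(* Defs.v *)
From HB Require Import structures.
From mathcomp Require Import all_boot all_order all_algebra.
From mathcomp Require Import ring_quotient mpoly.
From mathcomp Require Import boolp classical_sets functions cardinality.

Set Implicit Arguments.
Unset Strict Implicit.
Unset Printing Implicit Defensive.

Import GRing.Theory.
Local Open Scope classical_set_scope.
Local Open Scope ring_scope.

(* Families are indexed by nat from 1, so that [f] restricted to [1 .. r] is
   the family f_1, ..., f_r; the other values of [f] are never used. *)

Definition ideal_gen (R : comNzRingType) (f : nat -> R) (r : nat) : set R :=
  [set p | exists h : nat -> R, p = \sum_(1 <= i < r.+1) h i * f i].

Definition regular_sequence (R : comNzRingType) (f : nat -> R) (s : nat) : Prop :=
  (forall i : nat, (1 <= i <= s)%N ->
     forall g : R, ideal_gen f i.-1 (f i * g) -> ideal_gen f i.-1 g)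
  /\ ~ ideal_gen f s 1.

(* [l] counts the strict inclusions P_0 < ... < P_l. Since excluded middle is
   available in Type ([boolp.asbool]), the boolean predicates of
   [prime_idealr A] range over all prime ideals of [A]. *)
Definition prime_chain (A : comNzRingType) (l : nat)
    (P : 'I_l.+1 -> prime_idealr A) : Prop :=
  forall i j : 'I_l.+1, (i < j)%N ->
    [set x | x \in P i] `<` [set x | x \in P j].

Definition has_krull_dim (A : comNzRingType) (n : nat) : Prop :=
  (exists P : 'I_n.+1 -> prime_idealr A, prime_chain P)
  /\ (forall (l : nat) (P : 'I_l.+1 -> prime_idealr A),
        prime_chain P -> (l <= n)%N).

(* Points of the projective space P^(k-1)(K): the lines through 0 in K^k. *)
Definition proj_point (K : fieldType) (k : nat) : Type :=
  {U : {vspace 'rV[K]_k} | \dim U == 1%N}.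

Definition proj_zeros (K : fieldType) (k m : nat) (f : nat -> {mpoly K[k]}) :
    set (proj_point K k) :=
  [set P : proj_point K k | forall i : nat, (1 <= i <= m)%N ->
     forall v : 'rV[K]_k, v \in sval P -> (f i).@[v ord0] = 0].

(* dim V(J) = dim K[x_1, ..., x_k]/J - 1 for J = (f_1, ..., f_m). An [idealr]
   is proper; if (f_1, ..., f_m) is not, the quotient ring is zero and has no
   Krull dimension in nat. *)
Definition has_proj_dim (K : fieldType) (k m : nat) (f : nat -> {mpoly K[k]})
    (e : nat) : Prop :=
  exists J : idealr {mpoly K[k]},
    [set p | p \in J] = ideal_gen f m /\ has_krull_dim {ideal_quot J} e.+1.

(* Main.v *)
Require Import Defs.
From HB Require Import structures.
From mathcomp Require Import all_boot all_order all_algebra.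
From mathcomp Require Import mpoly.
From mathcomp Require Import ring_quotient boolp classical_sets functions.
From mathcomp Require Import cardinality.
From mathcomp Require Import ring zify.

(** Finitely many points of the projective space P^(k-1) that are the common
zeros of f_1, ..., f_m lie on a complete intersection g_1 = ... = g_(k-1) = 0
of dimension 0, whose equations belong to the ideal of the f_i.  A complete
intersection of dimension 0 has at most as many points as the product of its
degrees.  So the bound follows once the g_j are found with small degrees.

Dimension is measured on cones in K^k by linear sections: [dim_le s r] says
that r linear forms together with s have the origin as their only common
zero.  By the Nullstellensatz ([nullstellensatz], [trivzero_powers]) the
polynomial ring is then integral, modulo s, over the polynomials in these r
linear forms ([integral_mod]).  For r = 1 this means that the zeros of s form
finitely many lines ([finite_lines]), which generic elements of a linear
system of forms avoid unless the whole system vanishes on one of them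
([generic_avoiding]).  Three facts on dimension follow: removing an equation
raises it by at most one ([dim_le_behead]); adding a nonzero divisor lowers it
([dim_le_drop]); and so does adding a generic form of degree d from an ideal
of smaller dimension that is generated in degrees at most d ([dim_le_next]).

The g_j are chosen in [complete_intersection].  The first s are f_1, ..., f_s,
each of which lowers the dimension by regularity.  As the cone of zeros of
f_1, ..., f_m has dimension at most 1, that of f_1, ..., f_M has dimension at
most 1 + m - M.  For M = m - k + 1 + j this is k - j, and g_j can be taken to be
a generic form of degree d_M in the ideal of f_1, ..., f_M.

Bezout's inequality ([bezout_points]) is obtained by counting. Any k forms of
positive degree whose only common zero is the origin form a regular sequence
([regular_system]): this holds for the variables, and the forms can be
replaced one at a time, because modulo an ideal that admits a nonzero divisor
of positive degree, every form with a finite dimensional quotient is a nonzero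
divisor as well ([nonzerodiv_exchange]). A regular sequence determines the
Hilbert function of its quotient, which for k - 1 forms is bounded by the
product of the degrees ([hilbert_regseq_le]), whereas N points impose N
independent conditions on forms of degree N - 1
([separated_points_le_hilbert]).

It remains to translate the hypothesis on Krull dimension into
[dim_le _ 1], i.e. into the finiteness of the set of zeros.  The prime ideal
of the line through a zero v is contained in that of the origin, and so it
cannot contain a smaller prime ideal over the f_i; a prime ideal avoiding a
suitable multiplicative set shows that v is then isolated ([isolated_zero]).
Isolated zeros are finite in number: the polynomials that are nonzero on
finitely many of them only form an ideal without zeros, to which the
Nullstellensatz applies ([chain_condition_linform]). *)

Set Implicit Arguments.
Unset Strict Implicit.
Unset Printing Implicit Defensive.

Import GRing.Theory.
Local Open Scope classical_set_scope.
Local Open Scope ring_scope.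

(** * Ideals, regular sequences and prime ideals *)

Section Ideals.
Variable R : comNzRingType.
Implicit Types (I J P : set R) (a b c : R) (s : seq R).

Record is_ideal I : Prop := IsIdeal {
  ideal_0 : I 0;
  ideal_D : forall a b, I a -> I b -> I (a + b);
  ideal_M : forall c a, I a -> I (c * a) }.

(** The ideal I + (a). *)
Definition adjoin I a : set R := [set p | exists q c, I q /\ p = q + c * a].

Definition ideal_of s : set R := foldl adjoin [set 0] s.

Definition nonzerodiv I a : Prop := forall c, I (c * a) -> I c.

Fixpoint regseq I s : Prop :=
  if s is a :: s' then nonzerodiv I a /\ regseq (adjoin I a) s' else True.

Definition is_prime P : Prop :=
  [/\ is_ideal P, ~ P 1 & forall a b, P (a * b) -> P a \/ P b].

Lemma ideal_N I a : is_ideal I -> I a -> I (- a).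
Proof. by move=> hI Ia; rewrite -mulN1r; apply: ideal_M. Qed.

Lemma ideal_B I a b : is_ideal I -> I a -> I b -> I (a - b).
Proof. by move=> hI Ia Ib; apply: ideal_D => //; apply: ideal_N. Qed.

Lemma ideal_Mr I c a : is_ideal I -> I a -> I (a * c).
Proof. by move=> hI Ia; rewrite mulrC; apply: ideal_M. Qed.

Lemma ideal_sum I (T : Type) (r : seq T) (Q : pred T) (F : T -> R) :
  is_ideal I -> (forall i, Q i -> I (F i)) -> I (\sum_(i <- r | Q i) F i).
Proof.
move=> hI h; elim/big_ind: _ => //; first exact: ideal_0.
exact: ideal_D.
Qed.

Lemma ideal_sub_mem I a b : is_ideal I -> I (a - b) -> I b -> I a.
Proof. by move=> hI Iab Ib; rewrite -[a](subrK b); apply: ideal_D. Qed.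

Lemma zero_is_ideal : is_ideal [set 0].
Proof. by split=> //= [a b -> ->|c a ->]; rewrite ?addr0 ?mulr0. Qed.

Lemma adjoin_is_ideal I a : is_ideal I -> is_ideal (adjoin I a).
Proof.
move=> hI; split=> [|p q|c p].
- by exists 0, 0; split; [exact: ideal_0 | rewrite mul0r addr0].
- move=> [p1 [c1 [Ip ->]]] [q1 [c2 [Iq ->]]].
  by exists (p1 + q1), (c1 + c2); split; [exact: ideal_D | ring].
- move=> [p1 [c1 [Ip ->]]]; exists (c * p1), (c * c1).
  by split; [exact: ideal_M | ring].
Qed.

Lemma sub_adjoin I a : I `<=` adjoin I a.
Proof. by move=> p Ip; exists p, 0; rewrite mul0r addr0. Qed.

Lemma adjoin_gen I a : is_ideal I -> adjoin I a a.
Proof. by move=> hI; exists 0, 1; rewrite mul1r add0r; split=> //; apply: ideal_0. Qed.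

Lemma adjoin_min I J a : is_ideal J -> I `<=` J -> J a -> adjoin I a `<=` J.
Proof.
by move=> hJ sIJ Ja p [q [c [/sIJ Jq ->]]]; apply: ideal_D => //; apply: ideal_M.
Qed.

Lemma adjoinC I a b : adjoin (adjoin I a) b = adjoin (adjoin I b) a.
Proof.
suff h x y : adjoin (adjoin I x) y `<=` adjoin (adjoin I y) x.
  by apply/seteqP; split; apply: h.
move=> p [q [c [[q1 [c1 [Iq ->]]] ->]]].
by exists (q1 + c * y), c1; split; [exists q1, c | ring].
Qed.

Lemma foldl_adjoinC I s a : foldl adjoin (adjoin I a) s = adjoin (foldl adjoin I s) a.
Proof. by elim: s I => //= b s IH I; rewrite adjoinC IH. Qed.

Lemma ideal_of_rcons s a : ideal_of (rcons s a) = adjoin (ideal_of s) a.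
Proof. by rewrite /ideal_of foldl_rcons. Qed.

Lemma ideal_of_cons s a : ideal_of (a :: s) = adjoin (ideal_of s) a.
Proof. by rewrite /ideal_of /= foldl_adjoinC. Qed.

Lemma ideal_of_is_ideal s : is_ideal (ideal_of s).
Proof.
elim: s => [|a s IH]; first exact: zero_is_ideal.
by rewrite ideal_of_cons; apply: adjoin_is_ideal.
Qed.

Lemma mem_ideal_of s a : a \in s -> ideal_of s a.
Proof.
elim: s => // b s IH; rewrite ideal_of_cons inE => /orP [/eqP ->|/IH h].
  exact/adjoin_gen/ideal_of_is_ideal.
exact: sub_adjoin.
Qed.

Lemma ideal_of_min J s : is_ideal J -> (forall a, a \in s -> J a) -> ideal_of s `<=` J.
Proof.
move=> hJ; elim: s => [|a s IH] h; first by move=> p ->; apply: ideal_0.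
rewrite ideal_of_cons; apply: adjoin_min => //; last by apply: h; rewrite mem_head.
by apply: IH => b bs; apply: h; rewrite inE bs orbT.
Qed.

(** Zorn's lemma above a given set: as only nonempty chains are tested, Phi may
include conditions such as being an ideal. *)
Lemma exists_maximal_set (Phi : set R -> Prop) I :
  Phi I ->
  (forall F : set (set R), F !=set0 -> F `<=` Phi -> total_on F subset ->
     Phi (\bigcup_(X in F) X)) ->
  exists M, [/\ Phi M, I `<=` M & forall N, Phi N -> M `<=` N -> N `<=` M].
Proof.
move=> PhiI hF.
(* Zorn's lemma also asks about the empty chain; working with I `|` X makes
   its union the given set I. *)
have [|A [PA maxA]] := @Zorn_bigcup R (fun X => Phi (I `|` X)).
  move=> F FP totF; have [->|/set0P [X0 FX0]] := eqVneq F set0.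
    by rewrite bigcup_set0 setU0.
  have -> : I `|` \bigcup_(X in F) X =
            \bigcup_(Y in [set I `|` X | X in F]) Y.
    apply/seteqP; split=> p.
      case=> [Ip|[X FX Xp]]; last by exists (I `|` X); [exists X | right].
      by exists (I `|` X0); [exists X0 | left].
    by case=> _ [X FX <-] [Ip|Xp]; [left | right; exists X].
  apply: hF.
  - by exists (I `|` X0); exists X0.
  - by move=> _ [X FX <-]; apply: FP.
  - move=> _ _ [X FX <-] [Y FY <-].
    by case: (totF _ _ FX FY) => h; [left|right]; apply: setUS.
exists (I `|` A); split=> // N PhiN sN p Np.
apply: contrapT => nIA; apply: (maxA N).
  split=> [q Aq|sNA]; first by apply: sN; right.
  by apply: nIA; right; apply: sNA.
by rewrite (_ : I `|` N = N) //; apply/setUidPr => q Iq; apply: sN; left.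
Qed.

Lemma chain_is_ideal (F : set (set R)) :
  F !=set0 -> (forall X, F X -> is_ideal X) -> total_on F subset ->
  is_ideal (\bigcup_(X in F) X).
Proof.
move=> [X0 FX0] hF totF; split=> [|a b [X FX Xa] [Y FY Yb]|c a [X FX Xa]].
- by exists X0 => //; apply: ideal_0 (hF _ FX0).
- case: (totF _ _ FX FY) => h.
    by exists Y => //; apply: ideal_D (hF _ FY) _ _ _ _ => //; apply: h.
  by exists X => //; apply: ideal_D (hF _ FX) _ _ _ _ => //; apply: h.
- by exists X => //; apply: ideal_M (hF _ FX) _ _ _.
Qed.

(** Krull's construction: an ideal that is maximal among those over J and disjoint
from S is prime, since two ideals properly above it meet S and so does their
product. *)
Lemma prime_avoiding (J S : set R) :
  is_ideal J -> S 1 -> (forall a b, S a -> S b -> S (a * b)) ->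
  (forall a, J a -> ~ S a) ->
  exists P, [/\ is_prime P, J `<=` P & forall a, P a -> ~ S a].
Proof.
move=> hJ S1 SM JS.
have [||M [[hM MS] sJM maxM]] :=
  @exists_maximal_set (fun I => is_ideal I /\ forall a, I a -> ~ S a) J.
- by [].
- move=> F F0 hF totF; split.
    by apply: chain_is_ideal => // X /hF [].
  by move=> a [X /hF [_ XS] Xa]; apply: XS.
exists M; split=> //; split=> // [/MS//|a b Mab].
have meets c : ~ M c -> exists2 d, adjoin M c d & S d.
  move=> nMc; apply: contrapT => h; apply: nMc.
  apply: (maxM (adjoin M c)).
  - split; first exact: adjoin_is_ideal.
    by move=> d dM Sd; apply: h; exists d.
  - exact: sub_adjoin.
  - exact: adjoin_gen.
apply: contrapT => /not_orP [/meets [_ [q [c [Mq ->]]] Sd]].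
move=> /meets [_ [q' [c' [Mq' ->]]] Sd'].
(* The product of the two elements of S found above M lies in M. *)
apply: (MS _ _ (SM _ _ Sd Sd')).
have -> : (q + c * a) * (q' + c' * b) =
  q * (q' + c' * b) + (c * a) * q' + c * c' * (a * b) by ring.
by apply: (ideal_D hM); [apply: (ideal_D hM); [apply: ideal_Mr | apply: ideal_M]
  | apply: ideal_M].
Qed.

End Ideals.
Arguments adjoin {R} I a _.

(** * Graded ideals of the polynomial ring *)

Section Graded.
Variables (K : fieldType) (k : nat).
Local Notation R := {mpoly K[k]}.
Implicit Types (I : set R) (p q a b c : R) (s : seq R).

Definition graded I : Prop :=
  is_ideal I /\ forall d p, I p -> I (pihomog mdeg d p).

Definition posform p : Prop := exists2 d : nat, (0 < d)%N & p \is d.-homog.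

Definition posforms s : Prop := forall p, p \in s -> posform p.

(** For a graded ideal, this is finite dimensionality of the quotient. *)
Definition has_powers I : Prop := forall i : 'I_k, exists t, I ('X_i ^+ t).

Lemma posforms_cons a s : posforms (a :: s) <-> posform a /\ posforms s.
Proof.
split=> [h|[ha hs] p]; last by rewrite inE => /orP [/eqP ->|/hs].
by split=> [|p ps]; apply: h; rewrite inE ?eqxx // ps orbT.
Qed.

Lemma posforms_cat s1 s2 :
  posforms (s1 ++ s2) <-> posforms s1 /\ posforms s2.
Proof.
split=> [h|[h1 h2] p]; last by rewrite mem_cat => /orP [/h1|/h2].
by split=> p ps; apply: h; rewrite mem_cat ps ?orbT.
Qed.

Lemma pihomogM d e p a : a \is e.-homog ->
  pihomog mdeg d (p * a) =
  if (e <= d)%N then pihomog mdeg (d - e) p * a else 0.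
Proof.
move=> ha; rewrite {1}(pihomog_partitionE (leqnn (msize p))).
rewrite mulr_suml linear_sum /=.
have hM i : pihomog mdeg i p * a \is (i + e).-homog.
  by apply: dhomogM => //; apply: pihomogP.
case: leqP => [le_ed|lt_de]; last first.
  apply: big1 => i _; rewrite (@pihomog_ne0 _ _ _ (i + e)%N) //.
  by apply/eqP; lia.
have [lt_d|ge_d] := ltnP (d - e) (msize p).
  rewrite (bigD1 (Ordinal lt_d)) //= pihomog_dE; last first.
    by rewrite -[X in X.-homog](subnK le_ed).
  rewrite big1 ?addr0 // => i; rewrite -val_eqE /= => /eqP ne.
  by rewrite (@pihomog_ne0 _ _ _ (i + e)%N) //; apply/eqP; lia.
rewrite big1 => [|i _]; last first.
  rewrite (@pihomog_ne0 _ _ _ (i + e)%N) //; apply/eqP.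
  by have := ltn_ord i; lia.
suff -> : pihomog mdeg (d - e) p = 0 by rewrite mul0r.
rewrite pihomogE big_seq_cond big1 // => m /andP [mp /eqP hd].
by have := msize_mdeg_lt mp; rewrite hd; lia.
Qed.

Lemma dhomogXU_exp (i : 'I_k) n : ('X_i ^+ n : R) \is n.-homog.
Proof. by rewrite mpolyXn dhomogX /= mdegMn mdeg1 mul1n. Qed.

Lemma ideal_Z I (c : K) p : is_ideal I -> I p -> I (c *: p).
Proof. by move=> hI Ip; rewrite -mul_mpolyC; apply: ideal_M. Qed.

Lemma graded_comp I p :
  is_ideal I -> (forall d, I (pihomog mdeg d p)) -> I p.
Proof.
move=> hI h; rewrite (pihomog_partitionE (leqnn (msize p))).
exact: ideal_sum.
Qed.

Lemma adjoin_graded I a e : graded I -> a \is e.-homog -> graded (adjoin I a).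
Proof.
move=> [hI gI] ha; split; first exact: adjoin_is_ideal.
move=> d _ [q [c [Iq ->]]]; rewrite pihomogD (pihomogM _ _ ha).
exists (pihomog mdeg d q), (if (e <= d)%N then pihomog mdeg (d - e) c else 0).
by split; [exact: gI | case: ifP => _; rewrite ?mul0r].
Qed.

Lemma zero_graded : graded [set 0 : R].
Proof. by split=> [|d p /= ->]; [exact: zero_is_ideal | rewrite pihomog0]. Qed.

Lemma ideal_of_graded s : posforms s -> graded (ideal_of s).
Proof.
elim: s => [_|a s IH]; first exact: zero_graded.
move=> /posforms_cons [[d _ ha] hs]; rewrite ideal_of_cons.
by apply: adjoin_graded ha; apply: IH.
Qed.

(** A monomial of large degree contains a large power of one of the variables. *)
Lemma powers_degree I : is_ideal I -> has_powers I ->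
  exists T, forall d p, (T <= d)%N -> p \is d.-homog -> I p.
Proof.
move=> hI /choice [t ht]; exists (\sum_i t i).+1 => d p le_Td /dhomogP hp.
rewrite [p]mpolyE big_seq; apply: ideal_sum => // m mp.
rewrite -mul_mpolyC; apply: ideal_M => //.
have [i le_i] : exists i, (t i <= m i)%N.
  apply: contrapT => h; have eq_md : mdeg m = d := hp _ mp.
  suff: (mdeg m < d)%N by rewrite eq_md ltnn.
  apply: leq_trans le_Td; rewrite ltnS mdegE; apply: leq_sum => i _.
  by case: (leqP (t i) (m i)) => [le_ti|/ltnW//]; case: h; exists i.
have -> : m = ((U_(i) *+ t i) + (m - U_(i) *+ t i))%MM.
  apply/mnmP => j; rewrite mnmDE mnmBE mulmnE mnm1E.
  by case: eqP => [<-|_]; rewrite ?mul1n ?mul0n; move: le_i; clear; lia.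
by rewrite mpolyXD -mpolyXn; apply: ideal_Mr.
Qed.

(** Large powers of a lie in I + (b).  If c b is in I, multiplication by c maps
I + (b) into I, so some c a^T is in I, whence c is in I. *)
Lemma nonzerodiv_exchange I a b : is_ideal I -> posform a -> nonzerodiv I a ->
  has_powers (adjoin I b) -> nonzerodiv I b.
Proof.
move=> hI [e e0 ha] nza /(powers_degree (adjoin_is_ideal b hI)) [T hT] c Icb.
have [q [c' [Iq eq_aT]]] : adjoin I b (a ^+ T).
  by apply: (hT (e * T)%N); [rewrite leq_pmull | apply: dhomogMn].
have : I (c * a ^+ T).
  rewrite eq_aT (_ : _ * _ = c * q + c' * (c * b)); last by ring.
  by apply: (ideal_D hI); apply: ideal_M.
by elim: (T) => [|n IH]; [rewrite mulr1 | rewrite exprSr mulrA => /nza].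
Qed.

(** Together with [nonzerodiv_swapr], regular sequences of forms may be permuted.
This half needs the grading: elements of I + (a^n) for all n belong to I. *)
Lemma nonzerodiv_swapl I a b : graded I -> posform a ->
  nonzerodiv I a -> nonzerodiv (adjoin I a) b -> nonzerodiv I b.
Proof.
move=> [hI gI] [e e0 ha] nza nzb c Icb.
(* c lies in I + (a^n) for every n, and a^n has no component of degree < n. *)
have hn n : exists q m, I q /\ c = q + m * a ^+ n.
  elim: n => [|n [q [m [Iq ec]]]].
    by exists 0, c; split; [exact: ideal_0 | rewrite mulr1 add0r].
  have : I (m * b).
    have: I ((m * b) * a ^+ n).
      rewrite (_ : _ * _ = c * b - q * b); last by rewrite ec; ring.
      by apply: ideal_B => //; apply: ideal_Mr.
    by elim: (n) => [|n' IH]; [rewrite mulr1 | rewrite exprSr mulrA => /nza].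
  move=> /(@sub_adjoin _ _ a) /nzb [q' [m' [Iq' em]]].
  exists (q + q' * a ^+ n), m'; split; last by rewrite ec em exprS; ring.
  by apply: (ideal_D hI) => //; apply: ideal_Mr.
apply: graded_comp => // u; have [q [m [Iq ->]]] := hn u.+1.
rewrite pihomogD (pihomogM _ _ (dhomogMn u.+1 ha)) ifF ?addr0; first exact: gI.
by apply/negbTE; rewrite -ltnNge; apply: leq_trans (leq_pmull _ e0).
Qed.

Lemma nonzerodiv_swapr I a b : is_ideal I ->
  nonzerodiv I a -> nonzerodiv (adjoin I a) b -> nonzerodiv (adjoin I b) a.
Proof.
move=> hI nza nzb c [q [m [Iq ec]]].
have [q' [m' [Iq' em]]] : adjoin I a m.
  apply: nzb; exists (- q), c; split; first exact: ideal_N.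
  by rewrite ec; ring.
exists (c - m' * b), m'; split; last by ring.
apply: nza; rewrite (_ : _ * _ = q + q' * b); last by rewrite mulrBl ec em; ring.
by apply: (ideal_D hI) => //; apply: ideal_Mr.
Qed.

Lemma regseq_rcons I s a :
  regseq I (rcons s a) <-> regseq I s /\ nonzerodiv (foldl adjoin I s) a.
Proof.
elim: s I => [|b s IH] I /=; first by split=> [[]|[]].
by split=> [[h1 /IH [h2 h3]]|[[h1 h2] h3]]; split=> //; apply/IH.
Qed.

(** Iterated transpositions of neighbours move the last element to the front. *)
Lemma regseq_last_first I s a : graded I -> posforms (a :: s) ->
  regseq I (rcons s a) -> regseq I (a :: s).
Proof.
elim: s I => [|b s IH] I gI //.
move=> /posforms_cons [ha /posforms_cons [hb hs]] /= [nzb].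
have [e _ hbe] := hb.
case/(IH _ (adjoin_graded gI hbe)); first by apply/posforms_cons.
move=> nza hreg; split; first exact: nonzerodiv_swapl gI hb nzb nza.
split; last by rewrite adjoinC.
by apply: nonzerodiv_swapr => //; case: gI.
Qed.

End Graded.

(** * Integrality over a system of forms *)

Section Integral.
Variables (K : fieldType) (k : nat).
Local Notation R := {mpoly K[k]}.
Implicit Types (I : set R) (p q a b c : R) (s : seq R).

(** Modulo I, the polynomial ring is a finite module over the polynomials in the
entries of s, with the monomials of bounded degree as generators; the
characteristic polynomial of multiplication by f on these generators is the
required integral equation. *)
Lemma integral_mod I s (f : R) : graded I -> posforms s ->
  has_powers (foldl adjoin I s) ->
  exists2 chi : {poly {mpoly K[size s]}}, chi \is monic &
    I (map_poly (comp_mpoly (in_tuple s)) chi).[f].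
Proof.
move=> [hI gI] hs hpow.
have hIs s' : is_ideal (foldl adjoin I s').
  by elim: s' => [|a s' IH] //=; rewrite foldl_adjoinC; apply: adjoin_is_ideal.
have [T hT] := powers_degree (hIs s) hpow.
pose psi := comp_mpoly (in_tuple s).
(* The monomials of degree at most T generate the quotient; the bound is T.+1
   and not T so that 1 is one of them. *)
pose E : finType := 'X_{1..k < T.+1}.
pose S p := exists u : E -> {mpoly K[size s]},
  I (p - \sum_(e : E) psi (u e) * 'X_[val e]).
have SI p : I p -> S p.
  move=> Ip; exists (fun=> 0); rewrite big1 ?subr0 // => e _.
  by rewrite /psi raddf0 mul0r.
have SD p q : S p -> S q -> S (p + q).
  move=> [u hu] [v hv]; exists (fun e => u e + v e).
  rewrite (_ : _ - _ = (p - \sum_(e : E) psi (u e) * 'X_[val e]) +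
    (q - \sum_(e : E) psi (v e) * 'X_[val e])); first exact: ideal_D.
  have -> : \sum_(e : E) psi (u e + v e) * 'X_[val e] =
    \sum_(e : E) psi (u e) * 'X_[val e] + \sum_(e : E) psi (v e) * 'X_[val e].
    by rewrite -big_split; apply: eq_bigr => e _; rewrite /psi raddfD mulrDl.
  by ring.
have SM p a : a \in s -> S p -> S (p * a).
  move=> /(nthP 0) [i lt_i <-] [u hu].
  exists (fun e => 'X_(Ordinal lt_i) * u e).
  have -> : \sum_(e : E) psi ('X_(Ordinal lt_i) * u e) * 'X_[val e] =
      s`_i * \sum_(e : E) psi (u e) * 'X_[val e].
    rewrite mulr_sumr; apply: eq_bigr => e _.
    by rewrite /psi rmorphM /= comp_mpolyXU mulrA.
  rewrite (_ : _ - _ = s`_i * (p - \sum_(e : E) psi (u e) * 'X_[val e])).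
    exact: ideal_M.
  by ring.
(* In degree d > T, p is a combination of the entries of s modulo I, with
   coefficients of smaller degree since the entries have positive degree. *)
have Shom d p : p \is d.-homog -> S p.
  elim/ltn_ind: d p => d IH p hp.
  have [lt_dT|le_Td] := ltnP d T.+1.
    exists (fun e => (p@_(val e))%:MP).
    rewrite [X in X - _](@mpolywE _ _ T.+1).
      rewrite (_ : _ - _ = 0); first exact: ideal_0.
      apply/eqP; rewrite subr_eq0; apply/eqP/eq_bigr => e _.
      by rewrite /psi comp_mpolyC mul_mpolyC.
    rewrite msizeE; apply/bigmax_leqP_seq => m mp _.
    by have /dhomogP/(_ _ mp) /= -> := hp.
  have := hT d p (ltnW le_Td) hp; rewrite -[X in S X](pihomog_dE hp).
  have : {subset s <= s} by [].
  elim: {1 3}s p {hp} => [|a s' IHs] p sub /=.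
    by move=> Ip; apply/SI/gI.
  rewrite foldl_adjoinC => -[q [m [hq ->]]].
  have as_ : a \in s by apply: sub; rewrite mem_head.
  have [e e0 ha] := hs _ as_.
  have -> : pihomog mdeg d (q + m * a) = pihomog mdeg d q + pihomog mdeg d (m * a).
    exact: pihomogD.
  apply: SD; first by apply: IHs hq => x xs'; apply: sub; rewrite inE xs' orbT.
  rewrite (pihomogM _ _ ha); case: leqP => [le_ed|_]; last exact: SI (ideal_0 hI).
  apply: SM => //; apply: (IH (d - e)%N); last exact: pihomogP.
  by rewrite ltn_subrL e0 (leq_trans e0 le_ed).
have SA p : S p.
  rewrite (pihomog_partitionE (leqnn (msize p))).
  elim/big_rec: _ => [|i x _ Sx]; first exact: SI (ideal_0 hI).
  by apply: SD => //; apply: Shom (pihomogP _ _ _).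
have /choice [u hu] (e : E) := SA (f * 'X_[val e]).
pose M : 'M_#|E| := \matrix_(i, j) u (enum_val i) (enum_val j).
pose A : 'M[R]_#|E| := f%:M - map_mx psi M.
exists (char_poly M); first exact: char_poly_monic.
have -> : (map_poly psi (char_poly M)).[f] = \det A.
  rewrite map_char_poly /char_poly -horner_evalE -det_map_mx; congr (\det _).
  apply/matrixP => i j; rewrite !mxE /= horner_evalE hornerD hornerN hornerC.
  by rewrite hornerMn hornerX.
have hA i : I (\sum_j A i j * 'X_[val (enum_val j)]).
  rewrite (_ : \sum_j _ = f * 'X_[val (enum_val i)] -
     \sum_(e : E) psi (u (enum_val i) e) * 'X_[val e]); first exact: hu.
  rewrite (eq_bigr (fun j => f *+ (i == j) * 'X_[val (enum_val j)] -
     psi (u (enum_val i) (enum_val j)) * 'X_[val (enum_val j)])); last first.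
    by move=> j _; rewrite !mxE mulrBl.
  rewrite sumrB; congr (_ - _).
    rewrite (bigD1 i) //= eqxx big1 ?addr0 // => j.
    by rewrite eq_sym => /negbTE ->; rewrite mul0r.
  by rewrite [RHS](reindex _ (onW_bij _ (@enum_val_bij E))).
(* The matrix A kills the vector of generators modulo I, hence so does its
   determinant; read off the generator 1. *)
have e0 : (mdeg (0%MM : 'X_{1..k}) < T.+1)%N by rewrite mdeg0.
pose i0 := enum_rank (BMultinom e0 : E).
have -> : \det A = \sum_i (\adj A i0 i) * \sum_j A i j * 'X_[val (enum_val j)].
  under eq_bigr do rewrite mulr_sumr.
  rewrite exchange_big /=.
  transitivity (\sum_j ((\adj A *m A) i0 j) * 'X_[val (enum_val j)]).
    rewrite mul_adj_mx (bigD1 i0) //= mxE eqxx enum_rankK mpolyX0 mulr1.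
    rewrite big1 ?addr0 // => j.
    by rewrite mxE eq_sym => /negbTE ->; rewrite mul0r.
  apply: eq_bigr => j _; rewrite mxE mulr_suml; apply: eq_bigr => i _.
  by rewrite mulrA.
by apply: ideal_sum => // i _; apply: ideal_M.
Qed.

End Integral.

(** * Projective Nullstellensatz *)

Section IdealCongruence.
Variables (R : comNzRingType) (P : set R).
Hypothesis hP : is_ideal P.

Lemma ideal_congrM (a b c d : R) : P (a - b) -> P (c - d) -> P (a * c - b * d).
Proof.
move=> h1 h2; rewrite (_ : _ - _ = (a - b) * c + b * (c - d)); last by ring.
by apply: (ideal_D hP); [apply: ideal_Mr | apply: ideal_M].
Qed.

Lemma ideal_congr_refl (a : R) : P (a - a).
Proof. by rewrite subrr; apply: ideal_0. Qed.

Lemma ideal_congrX (a b : R) n : P (a - b) -> P (a ^+ n - b ^+ n).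
Proof.
move=> h; elim: n => [|n IH]; first exact: ideal_congr_refl.
by rewrite !exprS; apply: ideal_congrM.
Qed.

Lemma ideal_congr_prod (T : Type) (r : seq T) (F G : T -> R) :
  (forall i, P (F i - G i)) -> P (\prod_(i <- r) F i - \prod_(i <- r) G i).
Proof.
move=> h; elim/big_rec2: _ => [|i a b _ IH]; first exact: ideal_congr_refl.
exact: ideal_congrM.
Qed.

End IdealCongruence.

Section BinaryForm.
Variables (K : fieldType) (k : nat) (x y : {mpoly K[k]}).

(** The homogenization in degree N of the polynomial Q, in the variables x and y. *)
Definition binary_form N (Q : {poly K}) : {mpoly K[k]} :=
  \sum_(a < N.+1) Q`_a *: (x ^+ (N - a) * y ^+ a).

Lemma binary_form_root N (Q : {poly K}) z : (size Q <= N.+1)%N ->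
  binary_form N.+1 (('X - z%:P) * Q) = (y - z *: x) * binary_form N Q.
Proof.
move=> sQ; rewrite !mulrBl.
have -> : y * binary_form N Q = binary_form N.+1 ('X * Q).
  rewrite /binary_form [RHS]big_ord_recl coefXM eqxx scale0r add0r mulr_sumr.
  apply: eq_bigr => a _; rewrite coefXM /= subSS -scalerAr; congr (_ *: _).
  by rewrite exprS; ring.
have -> : z *: x * binary_form N Q = binary_form N.+1 (z%:P * Q).
  rewrite /binary_form [RHS]big_ord_recr /= coefCM (nth_default _ sQ) mulr0.
  rewrite scale0r addr0 mulr_sumr; apply: eq_bigr => a _.
  rewrite coefCM -scalerA -scalerAl -!scalerAr; congr (_ *: (_ *: _)).
  by rewrite subSn ?exprS ?mulrA // -ltnS.
rewrite /binary_form -sumrB; apply: eq_bigr => a _.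
by rewrite coefB scalerBl.
Qed.

End BinaryForm.

Section Nullstellensatz.
Variables (K : closedFieldType) (k : nat).
Local Notation R := {mpoly K[k]}.
Implicit Types (I P : set R) (p q a b c : R) (s : seq R).

(** Finitely many members of a chain have an upper bound in it; this carries the
condition [~ has_powers _], which concerns the k variables at once, to unions
of chains. *)
Lemma chain_upper (F : set (set R)) (J : finType) (G : J -> set R) :
  F !=set0 -> total_on F subset -> (forall i, F (G i)) ->
  exists2 X, F X & forall i, G i `<=` X.
Proof.
move=> [X0 FX0] totF FG.
suff [X FX h] : exists2 X, F X & forall i, i \in enum J -> G i `<=` X.
  by exists X => // i; apply: h; rewrite mem_enum.
elim: (enum J) => [|j s [X FX h]]; first by exists X0.
have [le_GX|le_XG] := totF _ _ (FG j) FX.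
  by exists X => // i; rewrite inE => /orP [/eqP ->|/h].
exists (G j) => // i; rewrite inE => /orP [/eqP ->//|/h sGX].
exact: subset_trans le_XG.
Qed.

(** This P behaves like the ideal of a single point: it is prime with respect to
forms, and adding any further form makes the quotient finite dimensional. *)
Lemma exists_maximal_graded I : graded I -> ~ has_powers I ->
  exists P, [/\ graded P, ~ has_powers P, I `<=` P &
    forall c d, c \is d.-homog -> ~ P c -> has_powers (adjoin P c)].
Proof.
move=> gI nI.
have [||P [[gP nP] sIP maxP]] :=
  @exists_maximal_set _ (fun M => graded M /\ ~ has_powers M) I.
- by [].
- move=> F F0 hF totF; split.
    split; first by apply: chain_is_ideal => // X /hF [[]].
    by move=> d p [X FX Xp]; exists X => //; case: (hF _ FX) => [[_ h] _]; apply: h.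
  move=> /choice [t ht].
  have /choice [G hG] (i : 'I_k) : exists X, F X /\ X ('X_i ^+ t i).
    by case: (ht i) => X FX Xi; exists X.
  have [X FX hX] := chain_upper F0 totF (fun i => (hG i).1).
  case: (hF _ FX) => _; apply=> i; exists (t i).
  by apply: hX; exact: (hG i).2.
exists P; split=> // c d hc nPc; apply: contrapT => nh; apply: nPc.
apply: (maxP (adjoin P c)); first by split=> //; apply: adjoin_graded hc.
- exact: sub_adjoin.
- by apply: adjoin_gen; case: gP.
Qed.

(** A form in one variable is a multiple of a power of it. *)
Lemma comp_pihomog_monovariate (x : 'I_k) (b : {mpoly K[1]}) d :
  exists beta, pihomog mdeg d (b \mPo in_tuple [:: 'X_x : R]) = beta *: 'X_x ^+ d.
Proof.
exists (\sum_(m <- msupp b | m ord0 == d) b@_m).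
rewrite comp_mpolyEX linear_sum /= scaler_suml [RHS]big_mkcond.
apply: eq_bigr => m _; rewrite linearZ /= comp_mpolyX big_ord1.
have hX : mdeg (U_(x) *+ m ord0)%MM = m ord0 by rewrite mdegMn mdeg1 mul1n.
rewrite (tnth_nth 0) /= mpolyXn pihomogX /= hX.
by case: eqP => [->|_]; rewrite ?mpolyXn ?scaler0.
Qed.

(** Since the quotient by P + ('X_x) is finite dimensional, 'X_j is integral over
K['X_x] modulo P, so P contains a binary form that is monic in 'X_j.  It
splits into linear factors over K, and one of them is in P by primality. *)
Lemma maximal_graded_linear P (x j : 'I_k) :
  graded P -> (forall t, ~ P ('X_x ^+ t)) ->
  (forall c d, c \is d.-homog -> ~ P c -> has_powers (adjoin P c)) ->
  exists z : K, P ('X_j - z *: 'X_x).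
Proof.
move=> gP nP hmax; have [hP compP] := gP.
have hX (i : 'I_k) : ('X_i : R) \is 1.-homog by rewrite dhomogX /= mdeg1.
have hprime a b d e : a \is d.-homog -> b \is e.-homog -> P (a * b) ->
    P a \/ P b.
  move=> ha hb Pab; apply: contrapT => /not_orP [nPa nPb].
  have [t [q [c [Pq et]]]] := hmax _ _ ha nPa x.
  have [t' [q' [c' [Pq' et']]]] := hmax _ _ hb nPb x.
  apply: (nP (t + t')%N); rewrite exprD et et'.
  have -> : (q + c * a) * (q' + c' * b) =
    q * (q' + c' * b) + (c * a) * q' + c * c' * (a * b) by ring.
  by apply: (ideal_D hP); [apply: (ideal_D hP); [apply: ideal_Mr |
    apply: ideal_M] | apply: ideal_M].
have hs : posforms [:: 'X_x : R].
  by move=> p; rewrite inE => /eqP ->; exists 1%N.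
have hpow : has_powers (foldl adjoin P [:: 'X_x]).
  by apply: hmax (hX x) _ => Px; apply: (nP 1%N).
have [chi chim Pchi] := integral_mod 'X_j gP hs hpow.
pose N := (size chi).-1.
have sN : size chi = N.+1 by rewrite prednK // size_poly_gt0 monic_neq0.
have /choice [beta hbeta] (a : nat) : exists be,
    pihomog mdeg (N - a) (chi`_a \mPo (in_tuple [:: 'X_x : R])) =
    be *: 'X_x ^+ (N - a).
  exact: comp_pihomog_monovariate.
(* The component of degree N of the integral equation is a monic binary form,
   which dehomogenizes to Q. *)
pose Q : {poly K} := 'X^N + \poly_(a < N) beta a.
have szlow : (size (\poly_(a < N) beta a) < size ('X^N : {poly K}))%N.
  by rewrite size_polyXn ltnS size_poly.
have sQ : size Q = N.+1 by rewrite /Q size_polyDl // size_polyXn.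
have Qm : Q \is monic.
  by apply/monicP; rewrite /Q lead_coefDl // lead_coefXn.
have PQ : P (binary_form 'X_x 'X_j N Q).
  have := compP N _ Pchi; rewrite (horner_coef_wide _ (size_poly _ _)) sN.
  rewrite linear_sum /=; congr P; apply: eq_bigr => -[u lt_u] _ /=.
  have hXu := dhomogXU_exp K j u.
  rewrite coef_poly lt_u (pihomogM _ _ hXu) -ltnS lt_u scalerAl; congr (_ * _).
  rewrite hbeta coefD coefXn coef_poly.
  have [->|ne_uN] := eqVneq u N; last first.
    have -> : (u < N)%N by rewrite ltn_neqAle ne_uN -ltnS.
    by rewrite add0r.
  rewrite ltnn addr0 scale1r; move: (hbeta N); rewrite subnn => <-.
  have -> : chi`_N = 1 by move/monicP: chim; rewrite lead_coefE.
  by rewrite comp_mpoly1 pihomog_dE // dhomog1.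
have [r eQ] := closed_field_poly_normal Q.
move: PQ; rewrite eQ (monicP Qm) scale1r.
have -> : N = size r.
  by move: sQ; rewrite eQ (monicP Qm) scale1r size_prod_XsubC => -[].
have hl z : ('X_j - z *: 'X_x : R) \is 1.-homog.
  by rewrite rpredB // rpredZ.
elim: r {eQ} => [|z r IH].
  rewrite big_nil /binary_form big_ord1 coefC eqxx scale1r !expr0 mulr1.
  by move=> P1; case: (nP 0%N).
rewrite big_cons /= binary_form_root ?size_prod_XsubC // => Pz.
have hb : binary_form 'X_x 'X_j (size r) (\prod_(j <- r) ('X - j%:P))
    \is (size r).-homog.
  rewrite /binary_form rpred_sum // => a _; rewrite rpredZ //.
  have := dhomogM (dhomogXU_exp K x (size r - a)) (dhomogXU_exp K j a).
  by rewrite subnK // -ltnS.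
by case: (hprime _ _ _ _ (hl z) hb Pz) => [Pl|/IH//]; exists z.
Qed.

(** A maximal graded ideal P over I that does not contain powers of all the
variables contains 'X_j - v_j 'X_x for all j, where 'X_x has no power in P.
The point v is then the required zero. *)
Lemma nullstellensatz I : graded I -> ~ has_powers I ->
  exists2 v : 'I_k -> K, exists i, v i != 0 & forall p, I p -> p.@[v] = 0.
Proof.
move=> gI nI; have [P [gP nP sIP hmax]] := exists_maximal_graded gI nI.
have [x nPx] : exists x : 'I_k, forall t, ~ P ('X_x ^+ t).
  apply: contrapT => h; apply: nP => i; apply: contrapT => h'.
  by apply: h; exists i => t Pt; apply: h'; exists t.
have /choice [v hv] j := maximal_graded_linear j gP nPx hmax.
have [hP compP] := gP; exists v.
  exists x; apply/eqP => vx0; apply: (nPx 1%N); rewrite expr1.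
  by have := hv x; rewrite vx0 scale0r subr0.
move=> p /sIP Pp; rewrite (pihomog_partitionE (leqnn (msize p))) raddf_sum /=.
apply: big1 => -[d _] _ /=; set pd := pihomog _ _ _.
have Ppd : P pd by apply: compP.
have hpd : pd \is d.-homog by apply: pihomogP.
apply: contrapT => /eqP ne0; apply: (nPx d).
(* Modulo P, a form of degree d is its value at v times the d-th power of
   'X_x, which is not in P. *)
have hX m : P ('X_[m] - (\prod_i v i ^+ m i) *: 'X_x ^+ mdeg m).
  rewrite mpolyXE_id -mul_mpolyC.
  have -> : (\prod_i v i ^+ m i)%:MP * 'X_x ^+ mdeg m =
     \prod_i (v i *: 'X_x) ^+ m i.
    under [RHS]eq_bigr do rewrite -mul_mpolyC exprMn.
    rewrite big_split /= -expr_sum -mdegE rmorph_prod; congr (_ * _).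
    by apply: eq_bigr => i _; rewrite rmorphXn.
  by apply: ideal_congr_prod => // i; apply: ideal_congrX.
have : P (pd - pd.@[v] *: 'X_x ^+ d).
  rewrite mevalE {1}[pd]mpolyE scaler_suml -sumrB big_seq.
  apply: ideal_sum => // m mpd; have <- : mdeg m = d := dhomog_mf hpd mpd.
  by rewrite -scalerA -scalerBr; apply: ideal_Z.
move=> h; rewrite -['X_x ^+ d]scale1r -(mulVf ne0) -scalerA.
apply: ideal_Z => //; rewrite -[_ *: _](subKr pd).
by apply: ideal_B.
Qed.

End Nullstellensatz.

(** * Zeros, linear sections and generic forms *)

Section ClosedFieldFacts.
Variable K : closedFieldType.

Lemma exists_notin (s : seq K) : exists x, x \notin s.
Proof.
have [->|s0] := eqVneq s [::]; first by exists 0.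
pose p := \prod_(a <- s) ('X - a%:P) + 1.
have sp : size p = (size s).+1.
  rewrite /p size_polyDl ?size_prod_XsubC // size_poly1.
  by case: s s0 {p}.
have /closed_rootP [x] : size p != 1%N by rewrite sp; case: s s0 {p sp}.
rewrite rootE /p hornerD hornerC horner_prod => hx; exists x.
apply: contraTN hx => xs; rewrite (big_rem x xs) /= hornerXsubC subrr mul0r add0r.
exact: oner_neq0.
Qed.

Lemma exists_nth_root (a : K) e : (0 < e)%N -> exists c, c ^+ e = a.
Proof.
move=> e0; have /closed_rootP [c] : size ('X^e - a%:P) != 1%N.
  by rewrite size_XnsubC // eqSS -lt0n.
by rewrite rootE !hornerE subr_eq0 => /eqP; exists c.
Qed.

End ClosedFieldFacts.

Section Points.
Variables (K : closedFieldType) (k : nat).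
Local Notation R := {mpoly K[k]}.
Implicit Types (I P : set R) (p q a b : R) (c : K) (s t L : seq R).
Implicit Types (v u : 'I_k -> K) (w : {ffun 'I_k -> K}).

Definition zeros s v : Prop := forall p, p \in s -> p.@[v] = 0.

Definition trivzero s : Prop := forall v, zeros s v -> forall i, v i = 0.

Definition linforms L : Prop := forall p, p \in L -> p \is 1.-homog.

(** The cone of common zeros has dimension at most r: it meets a suitable linear
subspace of codimension at most r in the origin only. *)
Definition dim_le s r : Prop :=
  exists L, [/\ size L = r, linforms L & trivzero (s ++ L)].

Lemma zeros_cons p s v : zeros (p :: s) v <-> p.@[v] = 0 /\ zeros s v.
Proof.
split=> [h|[hp hs] q]; last by rewrite inE => /orP [/eqP ->|/hs].
by split=> [|q qs]; apply: h; rewrite inE ?eqxx // qs orbT.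
Qed.

Lemma zeros_cat s1 s2 v : zeros (s1 ++ s2) v <-> zeros s1 v /\ zeros s2 v.
Proof.
split=> [h|[h1 h2] p]; last by rewrite mem_cat => /orP [/h1|/h2].
by split=> p ps; apply: h; rewrite mem_cat ps ?orbT.
Qed.

Lemma trivzero_sub s1 s2 : {subset s1 <= s2} -> trivzero s1 -> trivzero s2.
Proof. by move=> h t v zv; apply: t => p ps; apply/zv/h. Qed.

Lemma linforms_posforms L : linforms L -> posforms L.
Proof. by move=> h p /h; exists 1%N. Qed.

Lemma linforms_cons p L : linforms (p :: L) <-> p \is 1.-homog /\ linforms L.
Proof.
split=> [h|[hp hs] q]; last by rewrite inE => /orP [/eqP ->|/hs].
by split=> [|q qs]; apply: h; rewrite inE ?eqxx // qs orbT.
Qed.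

Lemma ideal_of_zeros s p v : zeros s v -> ideal_of s p -> p.@[v] = 0.
Proof.
move=> zv; apply: (@ideal_of_min _ [set p | p.@[v] = 0]) => [|a /zv //].
split=> /= [|a b' ha hb|b' a ha]; first by rewrite meval0.
  by rewrite mevalD ha hb addr0.
by rewrite mevalM ha mulr0.
Qed.

Lemma trivzero_powers s : posforms s -> trivzero s -> has_powers (ideal_of s).
Proof.
move=> hs ts; apply: contrapT => /(nullstellensatz (ideal_of_graded hs)).
move=> [v [i vi0] hv]; move/eqP: vi0; apply.
by apply: ts => p ps; apply/hv/mem_ideal_of.
Qed.

Lemma meval_scale p d (c : K) v u : p \is d.-homog ->
  (forall i, u i = c * v i) -> p.@[u] = c ^+ d * p.@[v].
Proof.
move=> hp hw; rewrite !mevalE mulr_sumr; apply: eq_big_seq => m mp.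
have <- : mdeg m = d := dhomog_mf hp mp.
rewrite mulrCA; congr (_ * _); rewrite mdegE expr_sum -big_split /=.
by apply: eq_bigr => i _; rewrite hw exprMn.
Qed.

Lemma zeros_scale s (c : K) v u : posforms s -> zeros s v ->
  (forall i, u i = c * v i) -> zeros s u.
Proof.
move=> hs zv hw p ps; have [d _ hp] := hs p ps.
by rewrite (meval_scale hp hw) zv ?mulr0.
Qed.

(** Each coordinate satisfies an integral equation over K[b] modulo s; where b is 1
this becomes an equation over K. *)
Lemma finite_coordinates b s : posforms (b :: s) -> trivzero (b :: s) ->
  exists rs : seq K, forall v, zeros s v -> b.@[v] = 1 -> forall j, v j \in rs.
Proof.
move=> hbs tbs; have [hb hs] := (posforms_cons b s).1 hbs.
have hpow := trivzero_powers hbs tbs; rewrite ideal_of_cons in hpow.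
suff /choice [rs hrs] : forall j, exists rs : seq K, forall v,
    zeros s v -> b.@[v] = 1 -> v j \in rs.
  exists (flatten (codom rs)) => v zv bv j; apply/flattenP; exists (rs j).
    exact: codom_f.
  exact: hrs.
move=> j; have hb1 : posforms [:: b] by move=> p; rewrite inE => /eqP ->.
have [chi chim hchi] :=
  @integral_mod _ _ (ideal_of s) [:: b] 'X_j (ideal_of_graded hs) hb1 hpow.
pose rho := map_poly (meval (fun=> 1 : K)) chi.
have [rs hrs] := closed_field_poly_normal rho.
exists rs => v zv bv.
have rhom : rho \is monic by apply: monic_map.
(* rho is the integral equation of 'X_j with b specialized to 1. *)
have : root rho (v j).
  rewrite rootE; apply/eqP; rewrite -[RHS](ideal_of_zeros zv hchi).
  rewrite -horner_map /= mevalXU -map_poly_comp; congr (_.[_]).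
  apply: eq_map_poly => x /=; rewrite comp_mpoly_meval; apply: meval_eq => i.
  by rewrite (tnth_nth 0) /=; case: i => -[|//] /= _; rewrite bv.
by rewrite hrs (monicP rhom) scale1r root_prod_XsubC.
Qed.

(** On the zeros of s other than the origin b does not vanish, so each line of
zeros contains a vector where b is 1, and there are finitely many of these. *)
Lemma finite_lines b s : posforms (b :: s) -> trivzero (b :: s) ->
  exists2 ps : seq {ffun 'I_k -> K}, forall w, w \in ps -> exists i, w i != 0 &
    forall v, zeros s v -> (exists i, v i != 0) ->
      exists w c, [/\ w \in ps, c != 0 & forall i, v i = c * w i].
Proof.
move=> hbs tbs; have [[e e0 hb] hs] := (posforms_cons b s).1 hbs.
have [rs hrs] := finite_coordinates hbs tbs.
pose ev (h : {ffun 'I_k -> seq_sub rs}) : {ffun 'I_k -> K} := [ffun i => val (h i)].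
exists [seq w : {ffun 'I_k -> K} <- codom ev | [exists i, w i != 0]].
  by move=> w; rewrite mem_filter => /andP [/existsP].
move=> v zv [i0 vi0].
have bv0 : b.@[v] != 0.
  apply: contraNneq vi0 => bv0; apply/eqP; apply: (tbs v).
  exact/zeros_cons.
(* Rescale v so that b takes the value 1 on it. *)
have [c hc] := exists_nth_root (b.@[v])^-1 e0.
have c0 : c != 0.
  apply/eqP => c0; move: hc; rewrite c0 expr0n gtn_eqF // => /esym/eqP.
  by rewrite invr_eq0 (negbTE bv0).
pose u i := c * v i.
have zu : zeros s u by apply: (zeros_scale hs zv).
have bu : b.@[u] = 1.
  by rewrite (@meval_scale _ _ c v u hb (fun=> erefl)) hc mulVf.
have hu := hrs u zu bu.
exists [ffun i => u i], c^-1; split; rewrite ?invr_eq0 //.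
  rewrite mem_filter; apply/andP; split.
    by apply/existsP; exists i0; rewrite ffunE mulf_neq0.
  apply/codomP; exists [ffun i => SeqSub (hu i)].
  by apply/ffunP => i; rewrite !ffunE.
by move=> i; rewrite ffunE /u mulKf.
Qed.

(** A vector space over an infinite field is not a finite union of proper
subspaces, here of those of the p in W that vanish at a given point. *)
Lemma generic_avoiding (W : set R) (ps : seq {ffun 'I_k -> K}) :
  W 0 -> (forall (c : K) p q, W p -> W q -> W (p + c *: q)) ->
  (forall w : {ffun 'I_k -> K}, w \in ps -> exists2 p, W p & p.@[w] != 0) ->
  exists2 g, W g & forall w : {ffun 'I_k -> K}, w \in ps -> g.@[w] != 0.
Proof.
move=> W0 hW; elim: ps => [|x ps IH] h; first by exists 0.
have [w wps|g Wg hg] := IH.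
  by apply: h; rewrite inE wps orbT.
have [p Wp px] := h x (mem_head _ _).
(* For each point at most one scalar is bad, namely - g / p. *)
have [c hc] := exists_notin [seq - g.@[w] / p.@[w] | w : {ffun 'I_k -> K} <- x :: ps].
exists (g + c *: p); first exact: hW.
move=> w wps; rewrite mevalD mevalZ.
have [pw0|pw0] := eqVneq p.@[w] 0.
  rewrite pw0 mulr0 addr0; move: wps; rewrite inE => /orP [/eqP ew|/hg//].
  by move: px; rewrite -ew pw0 eqxx.
apply: contraNneq hc => eq0; apply/mapP; exists w => //.
apply: (mulIf pw0); rewrite mulfVK //; apply/eqP.
by rewrite -addr_eq0 addrC; apply/eqP.
Qed.

Lemma linform_avoiding (ps : seq {ffun 'I_k -> K}) :
  (forall w, w \in ps -> exists i, w i != 0) ->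
  exists2 l : R, l \is 1.-homog & forall w : {ffun 'I_k -> K}, w \in ps -> l.@[w] != 0.
Proof.
move=> h; apply: (@generic_avoiding [set l | l \is 1.-homog]) => /=.
- exact: rpred0.
- by move=> c p q hp hq; rewrite rpredD // rpredZ.
- move=> w /h [i wi]; exists 'X_i; last by rewrite mevalXU.
  by have := dhomogXU_exp K i 1.
Qed.

(** One linear form serves two systems at once, as it only has to avoid finitely
many lines. *)
Lemma generic_linform a s b t :
  posforms (a :: s) -> trivzero (a :: s) ->
  posforms (b :: t) -> trivzero (b :: t) ->
  exists l, [/\ l \is 1.-homog, trivzero (l :: s) & trivzero (l :: t)].
Proof.
move=> h1 t1 h2 t2.
have [ps hps Zs] := finite_lines h1 t1; have [pt hpt Zt] := finite_lines h2 t2.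
have [w|l hl hlp] := @linform_avoiding (ps ++ pt).
  by rewrite mem_cat => /orP [/hps|/hpt].
have aux (qs : seq {ffun 'I_k -> K}) z : {subset qs <= ps ++ pt} ->
    (forall v, zeros z v -> (exists i, v i != 0) ->
      exists w c, [/\ w \in qs, c != 0 & forall i, v i = c * w i]) ->
    trivzero (l :: z).
  move=> sub Zu v /zeros_cons [lv zv] i; apply: contrapT => /eqP vi0.
  have [|w [c [wqs c0 hv]]] := Zu v zv; first by exists i.
  move/eqP: lv; rewrite (meval_scale hl hv) expr1 mulf_eq0 (negbTE c0) /=.
  by apply/negP/hlp/sub.
exists l; split=> //; first by apply: (aux ps) => // w h; rewrite mem_cat h.
by apply: (aux pt) => // w h; rewrite mem_cat h orbT.
Qed.

(** The linear forms that witness two bounds on the dimension can be chosen to be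
the same, by exchanging them one by one for generic ones. *)
Lemma common_linforms n r s t L1 L2 :
  posforms s -> posforms t -> linforms L1 -> linforms L2 ->
  size L1 = (n + r)%N -> size L2 = n ->
  trivzero (s ++ L1) -> trivzero (t ++ L2) ->
  exists L L3, [/\ size L = n, size L3 = r, linforms (L ++ L3),
    trivzero (s ++ L ++ L3) & trivzero (t ++ L)].
Proof.
elim: n s t L1 L2 => [|n IH] s t [|a L1] [|b L2] // hs ht hL1 hL2.
- move=> sq _ ts tt; exists [::], [::]; split=> //.
- by move=> sq _ ts tt; exists [::], (a :: L1).
move=> [sL1] [sL2] ts tt.
have [ha hL1'] := (linforms_cons _ _).1 hL1.
have [hb hL2'] := (linforms_cons _ _).1 hL2.
have hp p (u : seq R) L : posforms u -> linforms (p :: L) -> posforms (p :: u ++ L).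
  move=> hu /linforms_cons [hc hL]; apply/posforms_cons; split.
    by exists 1%N.
  by apply/posforms_cat; split=> //; apply: linforms_posforms.
have tr p (u : seq R) L : trivzero (u ++ p :: L) -> trivzero (p :: u ++ L).
  by apply: trivzero_sub => x; rewrite !(inE, mem_cat) orbCA.
have [l [hl tls tlt]] :=
  generic_linform (hp _ _ _ hs hL1) (tr _ _ _ ts) (hp _ _ _ ht hL2) (tr _ _ _ tt).
have hls (u : seq R) : posforms u -> posforms (l :: u).
  by move=> hu; apply/posforms_cons; split=> //; exists 1%N.
have [L [L3 [sL sL3 hLL t1 t2]]] :=
  IH _ _ _ _ (hls _ hs) (hls _ ht) hL1' hL2' sL1 sL2 tls tlt.
exists (l :: L), L3; split=> //=; first by rewrite sL.
- exact/linforms_cons.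
- by move: t1; apply: trivzero_sub => x; rewrite !(inE, mem_cat) orbCA.
- by move: t2; apply: trivzero_sub => x; rewrite !(inE, mem_cat) orbCA.
Qed.

(** Krull's height theorem in the form needed here: the equation a can be exchanged
for a linear form. *)
Lemma dim_le_behead a s r : posforms (a :: s) -> dim_le (a :: s) r -> dim_le s r.+1.
Proof.
move=> has [L [sL hL tL]]; have [_ hs] := (posforms_cons _ _).1 has.
have hp : posforms (a :: s ++ L).
  by apply/(posforms_cat (a :: s)); split=> //; apply: linforms_posforms.
have [l [hl tl _]] := generic_linform hp tL hp tL.
exists (l :: L); split=> /=; [by rewrite sL | exact/linforms_cons |].
by move: tl; apply: trivzero_sub => x; rewrite !(inE, mem_cat) orbCA.
Qed.

(** Cut by r common linear forms: s then has finitely many lines of zeros and t has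
none, hence on each of these lines some form of degree d in the ideal of t
is nonzero, and a generic one is nonzero on all of them. *)
Lemma dim_le_next s t d r : posforms s ->
  (forall p, p \in t -> exists e, [/\ (0 < e)%N, (e <= d)%N & p \is e.-homog]) ->
  dim_le s r.+1 -> dim_le t r ->
  exists g, [/\ g \is d.-homog, ideal_of t g & dim_le (g :: s) r].
Proof.
move=> hs ht [L1 [s1 hL1 t1]] [L2 [s2 hL2 t2]].
have ht' : posforms t by move=> p /ht [e [e0 _ he]]; exists e.
have [|L [[|l [|? ?]] [//sL _ hLl ts tt]]] :=
  common_linforms (r := 1) hs ht' hL1 hL2 _ s2 t1 t2; first by rewrite addn1.
have hL : linforms L by move=> p pL; apply: hLl; rewrite mem_cat pL.
have hl : l \is 1.-homog by apply: hLl; rewrite mem_cat mem_head orbT.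
have hsL : posforms (l :: s ++ L).
  apply/posforms_cons; split; first by exists 1%N.
  by apply/posforms_cat; split=> //; apply: linforms_posforms.
have tsL : trivzero (l :: s ++ L).
  by move: ts; apply: trivzero_sub => x; rewrite !(inE, mem_cat) orbA orbC.
have [ps hps Zs] := finite_lines hsL tsL.
(* The new form has to avoid the lines of zeros of s ++ L; on each of them
   some entry f of t is nonzero, and so is f times a power of a variable. *)
pose qs := [seq w : {ffun 'I_k -> K} <- ps | `[< zeros (s ++ L) w >]].
have [|c p q [hp Ip] [hq Iq]|w|g [hg Ig] gqs] :=
  @generic_avoiding [set g | g \is d.-homog /\ ideal_of t g] qs.
- by split; [exact: rpred0 | exact: ideal_0 (ideal_of_is_ideal t)].
- split; first by rewrite rpredD // rpredZ.
  have hIt := ideal_of_is_ideal t.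
  by apply: (ideal_D hIt) => //; apply: ideal_Z.
- rewrite mem_filter => /andP [/asboolP /zeros_cat [_ zL] /hps [i wi]].
  have [f ft fw] : exists2 f, f \in t & f.@[w] != 0.
    apply: contrapT => h; move/eqP: wi; apply; apply: tt.
    apply/zeros_cat; split=> // f ft; apply: contrapT => /eqP fw; apply: h.
    by exists f.
  have [e [_ le_ed hf]] := ht f ft.
  exists (f * 'X_i ^+ (d - e)); last first.
    by rewrite mevalM rmorphXn /= mevalXU mulf_neq0 // expf_neq0.
  split.
    rewrite -(subnKC le_ed); apply: dhomogM => //.
    by rewrite addKn; apply: dhomogXU_exp.
  by apply: ideal_Mr (ideal_of_is_ideal t) (mem_ideal_of ft).
exists g; split=> //; exists L; split=> // v /(zeros_cons g) [gv zv] i.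
apply: contrapT => /eqP vi0; have [|w [c [wps c0 hv]]] := Zs v zv.
  by exists i.
move/eqP: gv; rewrite (meval_scale hg hv) mulf_eq0 expf_eq0 (negbTE c0) andbF /=.
apply/negP/gqs; rewrite mem_filter wps andbT; apply/asboolP.
apply: (zeros_scale (c := c^-1) _ zv) => [|j].
  by have [] := (posforms_cons _ _).1 hsL.
by rewrite hv mulKf.
Qed.

End Points.

(** * Nonzero divisors lower the dimension *)

Lemma digits_inj D n (f g : nat -> nat) :
  (forall i, (i < n)%N -> (f i < D)%N) -> (forall i, (i < n)%N -> (g i < D)%N) ->
  (\sum_(i < n) f i * D ^ i = \sum_(i < n) g i * D ^ i)%N ->
  forall i, (i < n)%N -> f i = g i.
Proof.
elim: n f g => [|n IH] f g hf hg //.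
have split_sum (h : nat -> nat) :
    (\sum_(i < n.+1) h i * D ^ i = \sum_(i < n) h i.+1 * D ^ i * D + h 0)%N.
  rewrite big_ord_recl expn0 muln1 addnC; congr addn.
  by apply: eq_bigr => i _; rewrite /= expnSr mulnA.
rewrite !split_sum -!big_distrl /= => eq_fg.
have f0 := hf 0%N isT; have g0 := hg 0%N isT.
have eq0 : f 0%N = g 0%N.
  by have := congr1 (modn^~ D) eq_fg; rewrite !modnMDl !modn_small.
have D0 : (0 < D)%N by apply: leq_ltn_trans f0.
move: eq_fg; rewrite eq0 => /addIn /eqP; rewrite eqn_pmul2r // => /eqP eq_fg.
case=> [//|i lt_in]; apply: (IH (fun i => f i.+1) (fun i => g i.+1)) => // j jn.
  exact: hf.
exact: hg.
Qed.

Lemma mpoly_neq0_point (K : closedFieldType) n (b : {mpoly K[n]}) :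
  b != 0 -> exists c, b.@[c] != 0.
Proof.
move=> b0; pose D := msize b.
pose wt (m : 'X_{1..n}) := (\sum_(i < n) m i * D ^ i)%N.
(* Kronecker substitution: the exponents of a monomial of b are the digits of
   its weight in base D. *)
pose phi := \sum_(m <- msupp b) b@_m *: 'X^(wt m) : {poly K}.
have hphi x : phi.[x] = b.@[fun i => x ^+ (D ^ i)].
  rewrite horner_sum mevalE; apply: eq_bigr => m _.
  rewrite hornerZ hornerXn /wt expr_sum; congr (_ * _).
  by apply: eq_bigr => i _; rewrite mulnC exprM.
have phi0 : phi != 0.
  apply/eqP => /(congr1 (fun q : {poly K} => q`_(wt (mlead b)))).
  rewrite coef0 coef_sum (bigD1_seq (mlead b)) ?mlead_supp ?msupp_uniq //=.
  rewrite coefZ coefXn eqxx mulr1 big_seq_cond big1 ?addr0.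
    by apply/eqP; rewrite mleadc_eq0.
  move=> m /andP [mb ne]; rewrite coefZ coefXn; case: eqP; last by rewrite mulr0.
  move=> eq_wt; case/eqP: ne.
  pose dig (m : 'X_{1..n}) j := if insub j is Some i then m i else 0%N.
  have digE m' (i : 'I_n) : dig m' i = m' i by rewrite /dig valK.
  have lt_dig m' : m' \in msupp b -> forall i, (i < n)%N -> (dig m' i < D)%N.
    move=> m'b i lt_in; rewrite (digE m' (Ordinal lt_in)).
    apply: leq_ltn_trans (msize_mdeg_lt m'b); rewrite mdegE.
    by rewrite (bigD1 (Ordinal lt_in)) //= leq_addr.
  apply/mnmP => i; rewrite -!digE.
  apply: (digits_inj (lt_dig _ mb) (lt_dig _ (mlead_supp b0))) => //.
  rewrite (eq_bigr (fun i : 'I_n => m i * D ^ i)%N); last by move=> j _; rewrite digE.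
  rewrite -/(wt m) -eq_wt; apply: eq_bigr => j _; by rewrite digE.
have [x hx] : exists x, ~~ root phi x.
  have [rs hrs] := closed_field_poly_normal phi.
  have [x xrs] := exists_notin rs; exists x.
  by rewrite hrs rootZ ?lead_coef_eq0 // root_prod_XsubC.
by exists (fun i => x ^+ (D ^ i)); rewrite -hphi.
Qed.

Section DimensionDrop.
Variables (K : closedFieldType) (k : nat).
Local Notation R := {mpoly K[k]}.
Implicit Types (I : set R) (s L : seq R).

Lemma ideal_of_cat s L : ideal_of (s ++ L) = foldl adjoin (ideal_of s) L.
Proof. by rewrite /ideal_of foldl_cat. Qed.

(** Take an integral equation of f over the polynomials in the entries of L.  Powers
of f can be cancelled until the constant term b is nonzero, and the equation
shows that b is in I + (f). *)
Lemma nonzerodiv_eliminate I L f : graded I -> posforms L -> nonzerodiv I f ->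
  has_powers (foldl adjoin I L) ->
  exists2 b : {mpoly K[size L]}, b != 0 & adjoin I f (b \mPo (in_tuple L)).
Proof.
move=> gI hL nzf hpow; have [hI _] := gI.
have [chi chim] := integral_mod f gI hL hpow.
move: (monic_neq0 chim) => {chim}; elim/poly_ind: chi => [/eqP//|chi c IH].
rewrite rmorphD rmorphM /= map_polyX map_polyC /= hornerMXaddC.
have [->|c0] := eqVneq c 0.
  rewrite polyC0 comp_mpoly0 !addr0 => h Ih; apply: IH; last exact: nzf.
  by apply: contraNneq h => ->; rewrite mul0r.
move=> _ Ih; exists c => //.
exists ((map_poly (comp_mpoly (in_tuple L)) chi).[f] * f + (c \mPo in_tuple L)).
exists (- (map_poly (comp_mpoly (in_tuple L)) chi).[f]); split=> //.
by ring.
Qed.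

(** The ideal of f :: s contains a nonzero polynomial b in the r + 1 linear forms L
that witness the bound for s.  Take a point c with b(c) != 0.  The r
combinations of L that vanish on the line through c meet the cone of zeros of
f :: s in the origin only, since at another common zero the values of L would
be proportional to c. *)
Lemma dim_le_drop s f r : posforms s -> posform f -> dim_le s r.+1 ->
  nonzerodiv (ideal_of s) f -> dim_le (f :: s) r.
Proof.
move=> hs hf [[|l L] [//= [sL] hlL tsL]] nzf.
have hpow : has_powers (foldl adjoin (ideal_of s) (l :: L)).
  rewrite -ideal_of_cat; apply: trivzero_powers => //.
  by apply/posforms_cat; split=> //; apply: linforms_posforms.
have [b b0 hb] :=
  nonzerodiv_eliminate (ideal_of_graded hs) (linforms_posforms hlL) nzf hpow.
(* The factor 'X_ord0 makes the first coordinate of c nonzero, so that the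
   forms c_0 L_i - c_i l cut out the preimage of the line through c. *)
have [c hc] : exists c, (b * 'X_ord0).@[c] != 0.
  apply: mpoly_neq0_point; rewrite mulf_neq0 //.
  apply/eqP => /(congr1 (mcoeff U_(ord0))); rewrite mcoeffXU eqxx mcoeff0.
  by apply/eqP; rewrite oner_eq0.
move: hc; rewrite mevalM mevalXU mulf_eq0 negb_or => /andP [bc c0].
have [hl hL] := (linforms_cons _ _).1 hlL.
have hnew (i : 'I_(size L)) :
    c ord0 *: L`_i - c (lift ord0 i) *: l \is 1.-homog.
  by rewrite rpredB // rpredZ // hL // mem_nth.
exists [seq c ord0 *: L`_i - c (lift ord0 i) *: l | i : 'I_(size L)].
split; first by rewrite size_map size_enum_ord.
  by move=> _ /mapP [i _ ->].
move=> v; rewrite cat_cons => /(zeros_cat (f :: s)) [zv znew].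
have prop_l (i : 'I_(size L)) : c ord0 * (L`_i).@[v] = c (lift ord0 i) * l.@[v].
  apply/eqP; rewrite -subr_eq0 -!mevalZ -mevalB; apply/eqP/znew/mapP.
  by exists i; rewrite ?mem_enum.
have [lv|lv] := eqVneq l.@[v] 0.
  apply: tsL; apply/zeros_cat; split; first by case/zeros_cons: zv.
  apply/zeros_cons; split=> // p /(nthP 0) [i lt_i <-].
  have := prop_l (Ordinal lt_i); rewrite lv mulr0 => /eqP.
  by rewrite mulf_eq0 (negbTE c0) => /eqP.
(* Otherwise the linear forms take the value c at the multiple u of v, where
   b, a member of the ideal, would have to vanish. *)
case/negP: bc; pose u i := c ord0 / l.@[v] * v i.
have zu : zeros (f :: s) u.
  by apply: (zeros_scale (c := c ord0 / l.@[v]) _ zv) => //; apply/posforms_cons.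
rewrite -(ideal_of_zeros zu (p := b \mPo in_tuple (l :: L))); last by rewrite ideal_of_cons.
apply/eqP; rewrite comp_mpoly_meval; apply: meval_eq => i.
rewrite (tnth_nth 0) /=.
have hu p : p \is 1.-homog -> p.@[u] = c ord0 / l.@[v] * p.@[v].
  by move=> hp; rewrite (@meval_scale _ _ p 1 (c ord0 / l.@[v]) v u hp) ?expr1.
have [j ->|->] := unliftP ord0 i; last by rewrite /= hu // divfK.
have -> : (l :: L)`_(lift ord0 j) = L`_j by rewrite lift0.
rewrite hu; last by apply: hL; rewrite mem_nth //; exact: ltn_ord j.
by rewrite mulrAC prop_l mulfK.
Qed.

End DimensionDrop.

(** * Systems of parameters are regular sequences *)

Section RegularVariables.
Variables (K : fieldType) (k : nat).
Local Notation R := {mpoly K[k]}.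

Definition variables (xs : seq 'I_k) : seq R := [seq 'X_i | i <- xs].

(** The ideal of the variables with index in Y, described by its coefficients. *)
Definition var_ideal (Y : seq 'I_k) : set R :=
  [set p | forall m : 'X_{1..k}, (forall i, i \in Y -> m i = 0%N) -> p@_m = 0].

Lemma var_ideal_is_ideal Y : is_ideal (var_ideal Y).
Proof.
split=> [m _|p q hp hq m hm|c p hp m hm]; first by rewrite mcoeff0.
  by rewrite mcoeffD hp // hq // addr0.
rewrite mcoeffM big1 // => i /eqP em; rewrite hp ?mulr0 // => j jY.
have := congr1 (fun m' : 'X_{1..k} => m' j) em; rewrite /= mnmDE hm // => /esym/eqP.
by rewrite addn_eq0 => /andP [_ /eqP].
Qed.

Lemma var_ideal_cons i Y : adjoin (var_ideal Y) 'X_i = var_ideal (i :: Y).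
Proof.
apply/seteqP; split=> p.
  apply: adjoin_min; first exact: var_ideal_is_ideal.
    by move=> q hq m hm; apply: hq => j jY; apply: hm; rewrite inE jY orbT.
  move=> m hm; rewrite mcoeffX; case: eqP => // em.
  by have := hm i (mem_head _ _); rewrite -em mnm1E eqxx.
move=> hp.
exists (\sum_(m <- msupp p | m i == 0%N) p@_m *: 'X_[m]),
  (\sum_(m <- msupp p | m i != 0%N) p@_m *: 'X_[m - U_(i)]); split.
  move=> m hm; rewrite raddf_sum /= big1 // => m' /eqP m'i.
  rewrite mcoeffZ mcoeffX; case: eqP => [em|]; last by rewrite mulr0.
  rewrite em hp ?mul0r // => j; rewrite inE => /orP [/eqP ->|/hm//].
  by rewrite -em.
rewrite {1}[p]mpolyE (bigID (fun m : 'X_{1..k} => m i == 0%N)) /=; congr (_ + _).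
rewrite mulr_suml; apply: eq_bigr => m mi; rewrite -scalerAl -mpolyXD submK //.
apply/mnm_lepP => j; rewrite mnm1E; case: eqP => [<-|//].
by rewrite lt0n.
Qed.

Lemma var_ideal_nonzerodiv i Y : i \notin Y -> nonzerodiv (var_ideal Y) 'X_i.
Proof.
move=> iY p hp m hm; rewrite -(mcoeffMX p U_(i)) addmC; apply: hp => j jY.
rewrite mnmDE hm // add0n mnm1E; case: eqP => // eij.
by rewrite eij jY in iY.
Qed.

Lemma regseq_variables xs : uniq xs -> regseq [set 0] (variables xs).
Proof.
have -> : [set 0] = var_ideal [::].
  apply/seteqP; split=> p /= => [->|hp]; first by move=> m _; rewrite mcoeff0.
  by apply/mpolyP => m; rewrite mcoeff0 hp.
have : {in xs, forall i, i \notin [::]} by [].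
elim: xs [::] => //= i xs IH Y disj /andP [ixs uxs]; split.
  by apply/var_ideal_nonzerodiv/disj/mem_head.
rewrite var_ideal_cons; apply: IH => // j jxs.
rewrite inE negb_or (disj j) ?andbT; last by rewrite inE jxs orbT.
by apply: contraNneq ixs => <-.
Qed.

End RegularVariables.

Section RegularSystems.
Variables (K : closedFieldType) (k : nat).
Local Notation R := {mpoly K[k]}.
Implicit Types (I : set R) (a b : R) (s t L : seq R) (xs : seq 'I_k).
Implicit Types (v u : 'I_k -> K).

Lemma meval_linform (l : R) v u (x y : K) : l \is 1.-homog ->
  l.@[fun i => x * v i + y * u i] = x * l.@[v] + y * l.@[u].
Proof.
move=> hl; rewrite !mevalE !mulr_sumr -big_split /=.
apply: eq_big_seq => m ml.
have dm : mdeg m = 1%N := dhomog_mf hl ml.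
have /mdeg1P [i /eqP ->] : mdeg m == 1%N by rewrite dm.
have e w : \prod_j w j ^+ (U_(i)%MM j) = w i :> K.
  rewrite (bigD1 i) //= mnm1E eqxx expr1 big1 ?mulr1 // => j ne.
  by rewrite mnm1E eq_sym (negbTE ne).
by rewrite !e; ring.
Qed.

(** The zeros of the linear forms s make up at most a line, which is not contained
in all the coordinate hyperplanes. *)
Lemma trivzero_replace_variable b s (i0 : 'I_k) : b \is 1.-homog -> linforms s ->
  trivzero (b :: s) -> exists i, trivzero ('X_i :: s).
Proof.
move=> hb hs tbs.
have [ts|] := pselect (trivzero s).
  by exists i0; apply: trivzero_sub ts => x xs; rewrite inE xs orbT.
move=> nts; have [p [zp [i pi0]]] : exists p, zeros s p /\ exists i, p i != 0.
  apply: contrapT => h; apply: nts => v zv i; apply: contrapT => /eqP vi.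
  by apply: h; exists v; split=> //; exists i.
have bp : b.@[p] != 0.
  by apply: contraNneq pi0 => bp; apply/eqP/tbs/zeros_cons.
exists i => q /zeros_cons [] /=; rewrite mevalXU => qi zq.
(* A combination of the zeros p and q of s that is killed by b as well. *)
pose r j := b.@[p] * q j + - b.@[q] * p j.
have zr : zeros (b :: s) r.
  apply/zeros_cons; split; first by rewrite (meval_linform _ _ _ _ hb); ring.
  by move=> l ls; rewrite (meval_linform _ _ _ _ (hs l ls)) (zq l ls) (zp l ls) !mulr0 addr0.
have := tbs r zr i; rewrite /r qi mulr0 add0r => /eqP.
rewrite mulf_eq0 oppr_eq0 (negbTE pi0) orbF => /eqP bq.
by apply: tbs; apply/zeros_cons.
Qed.

Lemma regseq_exchange t a b : posforms (a :: t) -> posforms (b :: t) ->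
  trivzero (b :: t) -> regseq [set 0] (rcons t a) -> regseq [set 0] (b :: t).
Proof.
move=> hat hbt tbt /regseq_rcons [rt nza].
have [ha ht] := (posforms_cons _ _).1 hat.
apply: regseq_last_first => //; first exact: zero_graded.
apply/regseq_rcons; split=> //; apply: nonzerodiv_exchange ha nza _.
  exact: ideal_of_is_ideal.
by have := trivzero_powers hbt tbt; rewrite ideal_of_cons.
Qed.

Lemma variables_linforms xs : linforms (variables K xs).
Proof. by move=> _ /mapP [i _ ->]; have := dhomogXU_exp K i 1. Qed.

Lemma regular_variables xs : size xs = k -> trivzero (variables K xs) ->
  regseq [set 0] (variables K xs).
Proof.
move=> sxs txs; apply: regseq_variables.
apply: (leq_size_uniq (enum_uniq 'I_k)); last by rewrite size_enum_ord sxs.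
move=> i _; apply: contrapT => /negP ixs.
have zi : zeros (variables K xs) (fun j => (j == i)%:R : K).
  move=> _ /mapP [j jxs ->]; rewrite mevalXU.
  by case: eqP => // eji; rewrite -eji jxs in ixs.
by have /eqP := txs _ zi i; rewrite eqxx oner_eq0.
Qed.

(** Steinitz exchange from the variables to arbitrary independent linear forms. *)
Lemma regular_linforms L xs : linforms L -> (size L + size xs)%N = k ->
  trivzero (L ++ variables K xs) -> regseq [set 0] (L ++ variables K xs).
Proof.
elim: L xs => [|b L IH] xs; first by move=> _; apply: regular_variables.
move=> /linforms_cons [hb hL] sz tz.
have k0 : (0 < k)%N by rewrite -sz.
have hLx : linforms (L ++ variables K xs).
  by move=> p; rewrite mem_cat => /orP [/hL//|/variables_linforms].
have [i ti] := trivzero_replace_variable (Ordinal k0) hb hLx tz.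
have hX : posform ('X_i : R) by exists 1%N => //; have := dhomogXU_exp K i 1.
apply: (@regseq_exchange _ 'X_i) => //.
- by apply/posforms_cons; split=> //; apply: linforms_posforms.
- by apply/posforms_cons; split; [exists 1%N | apply: linforms_posforms].
rewrite -cats1 -catA (_ : variables K xs ++ _ = variables K (xs ++ [:: i])); last first.
  by rewrite /variables map_cat.
apply: IH => //; first by rewrite size_cat /= addn1 addnS.
apply: trivzero_sub ti => x; rewrite /variables map_cat !(inE, mem_cat) /=.
by rewrite orbC -orbA.
Qed.

(** The entries of s are exchanged for generic linear forms, one at a time. *)
Lemma regular_system s L : posforms s -> linforms L ->
  (size s + size L)%N = k -> trivzero (s ++ L) -> regseq [set 0] (s ++ L).
Proof.
elim: s L => [|b s IH] L.
  move=> _ hL sz tz; have := @regular_linforms L [::] hL; rewrite cats0.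
  by apply; rewrite // addn0.
move=> hbs hL sz tz; have [hb hs] := (posforms_cons _ _).1 hbs.
have hbsL : posforms (b :: s ++ L).
  by apply/(posforms_cat (b :: s)); split=> //; apply: linforms_posforms.
have [l [hl tl _]] := generic_linform hbsL tz hbsL tz.
apply: (@regseq_exchange _ l) => //.
  apply/posforms_cons; split; first by exists 1%N.
  by have [] := (posforms_cons _ _).1 hbsL.
rewrite -cats1 -catA; apply: IH => //.
- by move=> p; rewrite mem_cat inE => /orP [/hL//|/eqP ->].
- by rewrite size_cat addn1 addnS.
- by apply: trivzero_sub tl => x; rewrite !(inE, mem_cat) orbC -orbA.
Qed.

End RegularSystems.

(** * Hilbert functions and the inequality of Bezout *)

(** A subspace of maximal dimension among those contained in S is all of S. *)
Lemma vspace_of_pred (K : fieldType) (vT : vectType K) (S : vT -> Prop) :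
  S 0 -> (forall (c : K) u v, S u -> S v -> S (c *: u + v)) ->
  exists U : {vspace vT}, forall v, v \in U <-> S v.
Proof.
move=> S0 hS; pose P d :=
  `[< exists U : {vspace vT}, \dim U = d /\ forall v, v \in U -> S v >].
have exP : exists d, P d.
  exists 0%N; apply/asboolP; exists 0%VS; rewrite dimv0; split=> // v.
  by rewrite memv0 => /eqP ->.
have bP d : P d -> (d <= \dim {:vT})%N.
  by move=> /asboolP [U [<- _]]; apply/dimvS/subvf.
case: (ex_maxnP exP bP) => d /asboolP [U [dU US]] maxd.
exists U => v; split=> [/US //|Sv]; apply: contrapT => /negP vU.
have : P (\dim (U + <[v]>)%VS).
  apply/asboolP; exists (U + <[v]>)%VS; split=> // w /memv_addP [u uU [x /vlineP [c ->] ->]].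
  by rewrite addrC; apply: hS => //; apply: US.
move=> /maxd; rewrite -dU => le_dim.
have : (U + <[v]>)%VS == U by rewrite eq_sym eqEdim addvSl.
by move=> /eqP eU; case/negP: vU; rewrite -eU (subvP (addvSr _ _)) // memv_line.
Qed.

(** The number of monomials of degree t - u in m + 1 variables, i.e. the Hilbert
function of a polynomial ring in m + 1 variables shifted by u. *)
Definition shifted_bin m t u : nat := if (u <= t)%N then 'C(t - u + m, m) else 0%N.

Lemma shifted_bin_pascal m t u :
  shifted_bin m.+1 t u = (shifted_bin m t u + shifted_bin m.+1 t u.+1)%N.
Proof.
rewrite /shifted_bin; case: (ltngtP u t) => [lt_ut|//|->].
  have : (0 < t - u)%N by rewrite subn_gt0.
  rewrite subnS; case: (t - u)%N => // x _.
  by rewrite addSn binS addnC addSnnS.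
by rewrite subnn !binn.
Qed.

Lemma shifted_bin_sum m t u e :
  shifted_bin m.+1 t u =
  (\sum_(w < e) shifted_bin m t (u + w) + shifted_bin m.+1 t (u + e))%N.
Proof.
elim: e => [|e IH]; first by rewrite big_ord0 addn0.
by rewrite big_ord_recr /= IH -addnA addnS -shifted_bin_pascal.
Qed.

Section HilbertFunction.
Variables (K : closedFieldType) (n : nat).
Local Notation R := {mpoly K[n.+1]}.
Local Notation V := (dhomog n.+1 K).
Implicit Types (I : set R) (a b : R) (s : seq R).

Lemma dim_forms t : \dim {: V t} = 'C(t + n, n).
Proof. by rewrite dimvf /dim /= -[RHS]bin_sub ?leq_addl // addnK. Qed.

Lemma degree_part_subproof I t : exists U : {vspace V t},
  is_ideal I -> forall v, v \in U <-> I (val v).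
Proof.
have [hI|nI] := pselect (is_ideal I); last by exists 0%VS.
have [||U hU] := @vspace_of_pred _ (V t) (fun v => I (val v)).
- exact: ideal_0.
- by move=> c u v Iu Iv; apply: (ideal_D hI) => //; apply: ideal_Z.
by exists U.
Qed.

Definition degree_part I t : {vspace V t} := sval (cid (degree_part_subproof I t)).

Lemma degree_partP I t v : is_ideal I -> v \in degree_part I t <-> I (val v).
Proof. by move=> hI; rewrite /degree_part; case: cid => U /= /(_ hI) ->. Qed.

Definition hilbert I t : nat := (\dim {: V t} - \dim (degree_part I t))%N.

Lemma hilbert_dim I t : (\dim (degree_part I t) + hilbert I t = \dim {: V t})%N.
Proof. by rewrite subnKC // dimvS // subvf. Qed.

Section MulForm.
Variables (a : R) (e t : nat) (ha : a \is e.-homog) (le_et : (e <= t)%N).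

Lemma mul_form_subproof (c : V (t - e)) : val c * a \is t.-homog.
Proof. by have := dhomogM (dhomog_is_dhomog c) ha; rewrite (subnK le_et). Qed.

Definition mul_form (c : V (t - e)) : V t := DHomog (mul_form_subproof c).

Lemma mul_form_is_linear : linear mul_form.
Proof. by move=> c u v; apply: val_inj; rewrite /= mulrDl scalerAl. Qed.

HB.instance Definition _ := GRing.isLinear.Build K (V (t - e)) (V t) _ mul_form
  mul_form_is_linear.

(** Multiplication by a identifies the degree t - e part of the quotient by I with
the kernel of the projection from the quotient by I to that by I + (a) in
degree t. *)
Lemma hilbert_adjoin_ge I : graded I -> nonzerodiv I a ->
  (hilbert (adjoin I a) t + hilbert I (t - e) = hilbert I t)%N.
Proof.
move=> gI nza; have [hI compI] := gI; have hIa := adjoin_is_ideal a hI.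
pose f := linfun mul_form.
have fE c : val (f c) = val c * a by rewrite lfunE.
have eU : degree_part (adjoin I a) t = (degree_part I t + limg f)%VS.
  apply/vspaceP => v; apply/idP/idP.
    move=> /(degree_partP _ hIa) [q [c [Iq ev]]].
    have hq := pihomogP mdeg t q; have hc := pihomogP mdeg (t - e) c.
    have -> : v = (DHomog hq : V t) + f (DHomog hc : V (t - e)).
      apply: val_inj; rewrite [RHS]/= fE /= -[LHS](pihomog_dE (dhomog_is_dhomog v)) ev.
      by rewrite pihomogD (pihomogM _ _ ha) le_et.
    apply: memv_add; first by apply/(degree_partP _ hI)/compI.
    by rewrite memv_img // memvf.
  move=> /memv_addP [q /(degree_partP _ hI) Iq [_ /memv_imgP [c _ ->] ->]].
  apply/(degree_partP _ hIa); rewrite raddfD /= fE.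
  by exists (val q), (val c).
have eC : (degree_part I t :&: limg f)%VS = (f @: degree_part I (t - e))%VS.
  apply/vspaceP => v; apply/idP/idP.
    rewrite memv_cap => /andP [/(degree_partP _ hI) Iv /memv_imgP [c _ ec]].
    rewrite ec memv_img //; apply/(degree_partP _ hI)/nza.
    by rewrite -fE -ec.
  move=> /memv_imgP [c /(degree_partP _ hI) Ic ->]; rewrite memv_cap.
  rewrite memv_img ?memvf // andbT; apply/(degree_partP _ hI); rewrite fE.
  exact: ideal_Mr.
have sk : (lker f <= degree_part I (t - e))%VS.
  apply/subvP => c; rewrite memv_ker => /eqP fc0; apply/(degree_partP _ hI)/nza.
  by rewrite -fE fc0; apply: ideal_0.
have arith (A' A B C C' X Y Z k F L : nat) : (A' + X = C -> A + Z = C ->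
    B + Y = C' -> k + F = B -> k + L = C' -> A' + F = A + L -> X + Y = Z)%N.
  by lia.
have := dimv_sum_cap (degree_part I t) (limg f); rewrite -eU eC.
have := limg_ker_dim f fullv; rewrite capfv.
have := limg_ker_dim f (degree_part I (t - e)); rewrite (capv_idPr sk).
exact: (arith _ _ _ _ _ _ _ _ _ _ _
  (hilbert_dim (adjoin I a) t) (hilbert_dim I t) (hilbert_dim I (t - e))).
Qed.

End MulForm.

Lemma hilbert_adjoin_lt I a e t : graded I -> a \is e.-homog -> (t < e)%N ->
  hilbert (adjoin I a) t = hilbert I t.
Proof.
move=> [hI compI] ha lt_te; rewrite /hilbert; congr (_ - \dim _)%N.
apply/vspaceP => v; apply/idP/idP => /(degree_partP _ _) h.
  have [q [c [Iq ev]]] := h (adjoin_is_ideal a hI).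
  apply/(degree_partP _ hI); rewrite -(pihomog_dE (dhomog_is_dhomog v)) ev.
  by rewrite pihomogD (pihomogM _ _ ha) leqNgt lt_te addr0; apply: compI.
by apply/degree_partP; [exact: adjoin_is_ideal | apply/sub_adjoin/h].
Qed.

(** The Hilbert function of the quotient is that of a free module over a polynomial
ring in m + 1 variables, with generators in the degrees listed in l. *)
Definition hilbert_shifts I m (l : seq nat) : Prop :=
  forall t, hilbert I t = (\sum_(u <- l) shifted_bin m t u)%N.

(** A nonzero divisor of degree e trades one variable for e times as many
generators: the generating function of the quotient is multiplied by
1 - T^e = (1 - T)(1 + T + ... + T^(e-1)). *)
Lemma hilbert_shifts_adjoin I a e m l : graded I -> a \is e.-homog -> nonzerodiv I a ->
  hilbert_shifts I m.+1 l ->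
  hilbert_shifts (adjoin I a) m [seq (u + w)%N | u <- l, w <- iota 0 e].
Proof.
move=> gI ha nza hl t; rewrite big_allpairs_dep /=.
(* Shifting all the summands by e amounts to evaluating at t - e. *)
have shift_eq : (\sum_(u <- l) shifted_bin m.+1 t (u + e) =
   if (e <= t)%N then hilbert I (t - e) else 0)%N.
  case: leqP => [le_et|lt_te].
    rewrite hl; apply: eq_bigr => u _; rewrite /shifted_bin.
    by rewrite (leq_subRL _ le_et) (addnC u e) subnDA.
  apply: big1 => u _; rewrite /shifted_bin leqNgt ltn_addl //.
have := hl t; rewrite (eq_bigr _ (fun u _ => shifted_bin_sum m t u e)).
rewrite big_split /= shift_eq.
have -> : (\sum_(u <- l) \sum_(w < e) shifted_bin m t (u + w) =
           \sum_(u <- l) \sum_(w <- iota 0 e) shifted_bin m t (u + w))%N.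
  apply: eq_bigr => u _.
  by rewrite -(big_mkord xpredT (fun w => shifted_bin m t (u + w))) /index_iota subn0.
case: leqP => [le_et|lt_te].
  by have := hilbert_adjoin_ge ha le_et gI nza; lia.
by rewrite (hilbert_adjoin_lt gI ha lt_te) => ->; rewrite addn0.
Qed.

Lemma hilbert_shifts_regseq I m l s ds : graded I ->
  all2 (fun p d => p \is d.-homog) s ds -> regseq I s ->
  hilbert_shifts I (m + size s) l ->
  exists2 l', hilbert_shifts (foldl adjoin I s) m l' &
    size l' = (size l * \prod_(d <- ds) d)%N.
Proof.
elim: s ds I l => [|a s IH] [|d ds] // I l gI.
  by move=> _ _ h; exists l; rewrite ?big_nil ?muln1 // -[m]addn0.
move=> /andP [ha hs] [nza rs] hl /=.
have gIa := adjoin_graded gI ha.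
have hl' : hilbert_shifts I (m + size s).+1 l by rewrite -addnS.
have [l' hl'' sz] := IH ds _ _ gIa hs rs (hilbert_shifts_adjoin gI ha nza hl').
by exists l' => //; rewrite sz size_allpairs size_iota big_cons mulnA.
Qed.

Lemma hilbert_zero : hilbert_shifts [set 0] n [:: 0%N].
Proof.
move=> t; rewrite big_seq1 /shifted_bin subn0 -dim_forms /hilbert.
suff -> : degree_part [set 0] t = 0%VS by rewrite dimv0 subn0.
apply/vspaceP => v; rewrite memv0; apply/idP/eqP.
  by move=> /(degree_partP _ (zero_is_ideal _)) /= v0; apply: val_inj.
by move=> ->; apply: mem0v.
Qed.

(** After n steps one variable is left, and each generator contributes at most 1. *)
Lemma hilbert_regseq_le s ds t : size s = n ->
  all2 (fun p d => p \is d.-homog) s ds -> regseq [set 0] s ->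
  (hilbert (ideal_of s) t <= \prod_(d <- ds) d)%N.
Proof.
move=> sn hs rs.
have h0 : hilbert_shifts [set 0] (0 + size s) [:: 0%N] by rewrite sn; exact: hilbert_zero.
have [l hl sz] := hilbert_shifts_regseq (zero_graded _ _) hs rs h0.
rewrite hl -[X in (_ <= X)%N]mul1n -sz -sum1_size; apply: leq_sum => u _.
by rewrite /shifted_bin; case: ifP => // _; rewrite bin0.
Qed.

Section Evaluation.
Variables (N t : nat) (v : 'I_N -> 'I_n.+1 -> K).

Definition eval_forms (p : V t) : 'rV[K]_N := \row_i (val p).@[v i].

Lemma eval_forms_is_linear : linear eval_forms.
Proof.
by move=> c p q; apply/rowP => i; rewrite !mxE /= mevalD mevalZ.
Qed.

HB.instance Definition _ := GRing.isLinear.Build K (V t) 'rV[K]_N _ eval_forms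
  eval_forms_is_linear.

(** Evaluation at the points is a surjection from the forms of degree t onto K^N,
and it kills the ideal. *)
Lemma separated_points_le_hilbert s :
  (forall i, zeros s (v i)) ->
  (forall i, exists2 p : V t, (val p).@[v i] != 0 &
     forall j, j != i -> (val p).@[v j] = 0) ->
  (N <= hilbert (ideal_of s) t)%N.
Proof.
move=> zv sep; pose f := linfun eval_forms.
have full : limg f = fullv.
  apply/eqP; rewrite eqEsubv subvf /=; apply/subvP => w _.
  rewrite [w]row_sum_delta; apply: memv_suml => i _; apply: memvZ.
  have [p pi pj] := sep i.
  have -> : delta_mx 0 i = ((val p).@[v i])^-1 *: f p.
    apply/rowP => j; rewrite lfunE !mxE eqxx /=.
    by have [->|ne] := eqVneq j i; [exact/esym/mulVf | rewrite [X in _ * X](pj _ ne) mulr0].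
  by rewrite memvZ // memv_img // memvf.
have sk : (degree_part (ideal_of s) t <= lker f)%VS.
  apply/subvP => p /(degree_partP _ (ideal_of_is_ideal s)) Ip; rewrite memv_ker lfunE.
  by apply/eqP/rowP => i; rewrite !mxE (ideal_of_zeros (zv i) Ip).
have := limg_ker_dim f fullv; rewrite capfv full (dimvf 'rV[K]_N) /dim /= mul1n.
have arith (A B C D : nat) : (B + C = D -> A <= B -> forall H, A + H = D -> C <= H)%N.
  by lia.
by move/arith/(_ (dimvS sk)); apply; exact: hilbert_dim.
Qed.

End Evaluation.

Definition nonprop (u v : 'I_n.+1 -> K) : Prop :=
  ~ exists c, forall i, u i = c * v i.

Lemma separating_linform (u v : 'I_n.+1 -> K) : (exists i, v i != 0) ->
  nonprop u v -> exists l : R, [/\ l \is 1.-homog, l.@[u] != 0 & l.@[v] = 0].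
Proof.
move=> [i vi] nuv.
have [j hj] : exists j, u j * v i != u i * v j.
  apply: contrapT => h; apply: nuv; exists (u i / v i) => j.
  rewrite mulrAC; apply: (mulIf vi); rewrite mulfVK //.
  by apply/eqP/negPn/negP => ne; apply: h; exists j.
exists (v i *: 'X_j - v j *: 'X_i); split.
- by rewrite rpredB // rpredZ //; have := dhomogXU_exp K _ 1; apply.
- by rewrite mevalB !mevalZ !mevalXU subr_eq0 mulrC (mulrC (v j)).
- by rewrite mevalB !mevalZ !mevalXU mulrC subrr.
Qed.

(** The N points impose independent conditions in degree N - 1, because products of
N - 1 linear forms separate them. *)
Lemma bezout_points s ds l N (v : 'I_N -> 'I_n.+1 -> K) :
  size s = n -> posforms s -> all2 (fun p d => p \is d.-homog) s ds ->
  l \is 1.-homog -> trivzero (rcons s l) ->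
  (forall i, exists j, v i j != 0) -> (forall i j, i != j -> nonprop (v i) (v j)) ->
  (forall i, zeros s (v i)) -> (N <= \prod_(d <- ds) d)%N.
Proof.
move=> sn ps hs hl tl v0 npv zv.
have /regseq_rcons [rs _] : regseq [set 0] (rcons s l).
  rewrite -cats1; apply: regular_system => //; rewrite ?cats1 //.
    by move=> p; rewrite inE => /eqP ->.
  by rewrite sn addn1.
apply: leq_trans (hilbert_regseq_le N.-1 sn hs rs).
apply: separated_points_le_hilbert zv _ => i.
have /choice [g hg] (j : 'I_N) : exists l : R,
    l \is 1.-homog /\ (j != i -> l.@[v i] != 0 /\ l.@[v j] = 0).
  have [->|ne] := eqVneq j i.
    by exists 'X_ord0; split=> //; have := dhomogXU_exp K (ord0 : 'I_n.+1) 1; apply.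
  have ne' : i != j by rewrite eq_sym.
  by have [l' [h1 h2 h3]] := separating_linform (v0 j) (npv i j ne'); exists l'.
(* The product of the forms g j separates v i from all the other points. *)
have hp : \prod_(j < N | j != i) g j \is N.-1.-homog.
  have -> : N.-1 = (\sum_(j < N | j != i) 1)%N.
    by rewrite sum1_card cardC1 card_ord.
  elim/big_rec2: _ => [|j d q _ hq]; first exact: dhomog1.
  by apply: dhomogM => //; case: (hg j).
exists (DHomog hp) => /=.
  rewrite rmorph_prod /=; apply/prodf_neq0 => j ne.
  by case: (hg j) => _ /(_ ne) [].
move=> j ne; rewrite rmorph_prod (bigD1 j) //=.
by case: (hg j) => _ /(_ ne) [_ ->]; rewrite mul0r.
Qed.

End HilbertFunction.

(** * Chains of prime ideals in the quotient ring *)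

Lemma ideal_genE (R : comNzRingType) (f : nat -> R) r :
  ideal_gen f r = ideal_of [seq f i | i <- iota 1 r].
Proof.
elim: r => [|r IH].
  apply/seteqP; split=> p; first by move=> [h ->]; rewrite big_geq.
  by move=> ->; exists (fun=> 0); rewrite big_geq.
have -> : iota 1 r.+1 = rcons (iota 1 r) r.+1.
  by rewrite -(addn1 r) iotaD /= cats1 addnC.
rewrite map_rcons ideal_of_rcons -IH; apply/seteqP; split=> p.
  move=> [h ->]; rewrite big_nat_recr //=.
  by exists (\sum_(1 <= i < r.+1) h i * f i), (h r.+1); split=> //; exists h.
move=> [q [c [[h ->] ->]]].
exists (fun i => if i == r.+1 then c else h i).
rewrite [RHS]big_nat_recr //; congr (_ + _); last by rewrite /= eqxx.
by apply: eq_big_nat => i /andP [_ lt_i]; rewrite ltn_eqF.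
Qed.

Section QuotientPrime.
Variables (R : comNzRingType) (J : idealr R) (P : set R).
Hypotheses (primeP : is_prime P) (sJP : forall a, a \in J -> P a).

(** As P contains J, membership in its image can be tested on a representative. *)
Definition quot_pred : {ideal_quot J} -> bool := fun x => `[< P (repr x) >].

Lemma quot_predE a : quot_pred (\pi_({ideal_quot J})%qT a) = `[< P a >].
Proof.
have [hP _ _] := primeP.
have Jd : repr (\pi_({ideal_quot J})%qT a) - a \in J.
  by rewrite Quotient.idealrBE reprK.
apply/asboolP/asboolP => h; last exact: ideal_sub_mem (sJP Jd) h.
by apply: ideal_sub_mem h => //; rewrite -opprB; apply: ideal_N => //; apply: sJP.
Qed.

Lemma quot_pred_idealr : idealr_closed quot_pred.
Proof.
have [hP nP1 _] := primeP; split.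
- rewrite -[0](raddf0 (\pi_({ideal_quot J})%qT)) [_ \in _]quot_predE.
  by apply/asboolP; exact: ideal_0 hP.
- rewrite -[1](rmorph1 (\pi_({ideal_quot J})%qT)) [_ \notin _]/(~~ quot_pred _) quot_predE.
  by apply/negP => /asboolP.
- move=> x u v; rewrite -[x]reprK -[u]reprK -[v]reprK.
  rewrite -rmorphM -rmorphD ![_ \in _]quot_predE => /asboolP Pu /asboolP Pv.
  by apply/asboolP; apply: (ideal_D hP) => //; apply: ideal_M.
Qed.

Lemma quot_pred_prime : prime_idealr_closed quot_pred.
Proof.
have [hP nP1 PM] := primeP => x y.
rewrite -[x]reprK -[y]reprK -rmorphM ![_ \in _]quot_predE => /asboolP /PM [h|h].
  by apply/orP; left; apply/asboolP.
by apply/orP; right; apply/asboolP.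
Qed.

HB.instance Definition _ := isIdealr.Build {ideal_quot J} quot_pred quot_pred_idealr.
HB.instance Definition _ :=
  isPrimeIdealrClosed.Build {ideal_quot J} quot_pred quot_pred_prime.

Lemma quot_prime_exists : exists Q : prime_idealr {ideal_quot J},
  forall a, (\pi_({ideal_quot J})%qT a \in Q) = `[< P a >].
Proof. by exists quot_pred => a; apply: quot_predE. Qed.

End QuotientPrime.

Lemma krull_dim1_no_chain (R : comNzRingType) (J : idealr R) (P0 P1 P2 : set R) :
  has_krull_dim {ideal_quot J} 1 ->
  is_prime P0 -> is_prime P1 -> is_prime P2 -> (forall a, a \in J -> P0 a) ->
  P0 `<` P1 -> P1 `<` P2 -> False.
Proof.
move=> [_ maxchain] p0 p1 p2 s0 [s01 n01] [s12 n12].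
have s1 a : a \in J -> P1 a by move=> /s0 /s01.
have s2 a : a \in J -> P2 a by move=> /s1 /s12.
have [Q0 hQ0] := quot_prime_exists p0 s0.
have [Q1 hQ1] := quot_prime_exists p1 s1.
have [Q2 hQ2] := quot_prime_exists p2 s2.
pose Q (i : 'I_3) := nth Q2 [:: Q0; Q1] i.
suff : prime_chain Q by move=> /(maxchain 2 Q).
have sub (A B : set R) (QA QB : prime_idealr {ideal_quot J}) :
    (forall a, (\pi_({ideal_quot J})%qT a \in QA) = `[< A a >]) ->
    (forall a, (\pi_({ideal_quot J})%qT a \in QB) = `[< B a >]) ->
    A `<` B -> [set x | x \in QA] `<` [set x | x \in QB].
  move=> hA hB [sAB nAB]; split=> [x /=|h].
    by rewrite -[x]reprK hA hB => /asboolP /sAB /asboolP.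
  apply: nAB => a Ba; apply/asboolP; rewrite -hA; apply: h => /=.
  by rewrite hB; apply/asboolP.
move=> [[|[|[|//]]] ?] [[|[|[|//]]] ?] //= _.
- exact: sub hQ0 hQ1 _.
- by apply: sub hQ0 hQ2 _; split=> [a /s01 /s12|h] //; apply: n01 => a /s12 /h.
- exact: sub hQ1 hQ2 _.
Qed.

(** * Krull dimension one and finitely many zeros *)

Section Lines.
Variables (K : closedFieldType) (k : nat).
Local Notation R := {mpoly K[k]}.
Implicit Types (I : set R) (p a b : R) (s : seq R) (v u : 'I_k -> K).

(** The restriction of a polynomial to the line K v, parametrized by T -> T v. *)
Definition restrict_line v : R -> {poly K} := mmap (@polyC K) (fun i => v i *: 'X).

Lemma restrict_lineD v p q :
  restrict_line v (p + q) = restrict_line v p + restrict_line v q.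
Proof. exact: mmapD. Qed.

Lemma restrict_lineM v p q :
  restrict_line v (p * q) = restrict_line v p * restrict_line v q.
Proof. exact: rmorphM. Qed.

Lemma restrict_lineX v i : restrict_line v 'X_i = v i *: 'X.
Proof. by rewrite /restrict_line mmapX mmap1U. Qed.

(** Thus a polynomial vanishes on the line if and only if its homogeneous
components vanish at v. *)
Lemma coef_restrict_line v p d :
  (restrict_line v p)`_d = (pihomog mdeg d p).@[v].
Proof.
rewrite /restrict_line /mmap coef_sum pihomogE raddf_sum /= [RHS]big_mkcond.
apply: eq_bigr => m _; rewrite coefCM.
have -> : mmap1 (fun i => v i *: 'X) m = (\prod_i v i ^+ m i) *: 'X^(mdeg m).
  rewrite /mmap1 mdegE expr_sum -scaler_prod.
  by apply: eq_bigr => i _; rewrite exprZn.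
rewrite coefZ coefXn mevalZ mevalX [X in if X then _ else _]eq_sym.
by case: eqP => _; rewrite ?mulr1 ?mulr0.
Qed.

Lemma horner_restrict_line v p c :
  (restrict_line v p).[c] = p.@[fun i => c * v i].
Proof.
rewrite /restrict_line /mmap horner_sum mevalE; apply: eq_bigr => m _.
rewrite hornerCM; congr (_ * _); rewrite /mmap1 horner_prod.
by apply: eq_bigr => i _; rewrite horner_exp hornerZ hornerX mulrC.
Qed.

Lemma restrict_line_neq0 v p : restrict_line v p != 0 ->
  exists2 c, c != 0 & p.@[fun i => c * v i] != 0.
Proof.
move=> p0; have [rs hrs] := closed_field_poly_normal (restrict_line v p).
have [c] := exists_notin (0 :: rs); rewrite inE negb_or => /andP [c0 crs].
exists c => //; rewrite -horner_restrict_line -[_ == 0]/(root _ _) hrs.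
by rewrite rootZ ?lead_coef_eq0 // root_prod_XsubC.
Qed.

Lemma line_ideal_prime v : is_prime [set p | restrict_line v p = 0].
Proof.
split=> /= [|/eqP|a b].
- split=> /= [|a b ha hb|c a ha]; first exact: mmap0.
    by rewrite restrict_lineD ha hb addr0.
  by rewrite restrict_lineM ha mulr0.
- by rewrite /restrict_line rmorph1 oner_eq0.
- by rewrite restrict_lineM => /eqP; rewrite mulf_eq0 => /orP [] /eqP; [left|right].
Qed.

Lemma origin_ideal_prime : is_prime [set p : R | p.@[fun=> 0] = 0].
Proof.
split=> /= [|/eqP|a b].
- split=> /= [|a b ha hb|c a ha]; first exact: meval0.
    by rewrite mevalD ha hb addr0.
  by rewrite mevalM ha mulr0.
- by rewrite meval1 oner_eq0.
- by rewrite mevalM => /eqP; rewrite mulf_eq0 => /orP [] /eqP; [left|right].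
Qed.

Section ChainCondition.
Variable s : seq R.
Hypothesis hs : posforms s.
Hypothesis no_chain : forall P0 P1 P2 : set R,
  is_prime P0 -> is_prime P1 -> is_prime P2 -> ideal_of s `<=` P0 ->
  P0 `<` P1 -> P1 `<` P2 -> False.

(** In the local ring of the line, b is nilpotent modulo s: otherwise a prime ideal
over s inside the ideal of the line would miss b, and the ideal of the origin
would complete a chain of three primes. *)
Lemma locally_nilpotent v b : (exists i, v i != 0) -> restrict_line v b = 0 ->
  exists a n, restrict_line v a != 0 /\ ideal_of s (a * b ^+ n).
Proof.
move=> [i vi] hb; apply: contrapT => h.
(* A prime ideal avoiding S lies in the ideal of the line and misses b. *)
pose S : set R := [set x | exists a n, restrict_line v a != 0 /\ x = a * b ^+ n].
have v1 : restrict_line v 1 = 1 by rewrite /restrict_line rmorph1.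
have [||a Ia [x [n [hx ea]]]|P0 [p0 sIP nPS]] :=
  @prime_avoiding _ (ideal_of s) S (ideal_of_is_ideal s).
- by exists 1, 0%N; rewrite v1 oner_neq0 mulr1.
- move=> _ _ [x [n [hx ->]]] [y [n' [hy ->]]].
  exists (x * y), (n + n')%N; split; last by rewrite exprD; ring.
  by rewrite restrict_lineM mulf_neq0.
- by apply: h; exists x, n; rewrite -ea.
apply: (no_chain p0 (line_ideal_prime v) origin_ideal_prime sIP).
  split=> [a P0a /=|sub].
    apply: contrapT => /eqP ha; apply: (nPS _ P0a).
    by exists a, 0%N; rewrite mulr1.
  apply: (nPS b); first exact: sub.
  by exists 1, 1%N; rewrite v1 oner_neq0 mul1r.
split=> [a /= ha|sub].
  have e := horner_restrict_line v a 0; rewrite ha horner0 in e.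
  by rewrite [RHS]e; apply: meval_eq => j; rewrite mul0r.
have : restrict_line v 'X_i = 0 by apply: sub => /=; rewrite mevalXU.
by rewrite restrict_lineX => /eqP; rewrite scaler_eq0 polyX_eq0 orbF (negbTE vi).
Qed.

(** The polynomials v_j 'X_i - v_i 'X_j cut out the line; multiply the cofactors a
that [locally_nilpotent] gives for them. *)
Lemma isolated_zero v : (exists i, v i != 0) ->
  exists2 a, restrict_line v a != 0 &
    forall u, zeros s u -> a.@[u] != 0 -> exists c, forall i, u i = c * v i.
Proof.
move=> v0; have [j vj] := v0.
have /choice [a ha] (i : 'I_k) : exists a : R, restrict_line v a != 0 /\
    exists n, ideal_of s (a * (v j *: 'X_i - v i *: 'X_j) ^+ n).
  have [||a [n [h1 h2]]] := @locally_nilpotent v (v j *: 'X_i - v i *: 'X_j).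
  - exact: v0.
  - rewrite -!mul_mpolyC -mulNr -mpolyCN restrict_lineD !restrict_lineM !restrict_lineX.
    rewrite /restrict_line !mmapC !mul_polyC !scalerA -scalerDl.
    by rewrite mulNr (mulrC (v i)) subrr scale0r.
  by exists a; split=> //; exists n.
exists (\prod_i a i).
  rewrite /restrict_line rmorph_prod; apply/prodf_neq0 => i _.
  exact: (ha i).1.
move=> u zu; rewrite rmorph_prod => /prodf_neq0 hu; exists (u j / v j) => i.
have [_ [n hn]] := ha i.
have := ideal_of_zeros zu hn; rewrite mevalM rmorphXn /= mevalB !mevalZ !mevalXU.
move/eqP; rewrite mulf_eq0 (negbTE (hu i isT)) /= expf_eq0 => /andP [_].
rewrite subr_eq0 => /eqP e; apply: (mulfI vj); rewrite e.
by rewrite [RHS]mulrA [RHS]mulrC (mulrC (v j)) divfK.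
Qed.

Lemma chain_condition_linform :
  exists2 l, l \is 1.-homog & trivzero (l :: s).
Proof.
(* I consists of the polynomials that are nonzero on finitely many lines of
   zeros of s only; isolated zeros leave no common zero to I. *)
pose I : set R := [set a | exists T : seq {ffun 'I_k -> K}, forall u,
  zeros s u -> a.@[u] != 0 -> exists w c, w \in T /\ forall i, u i = c * w i].
have hI : is_ideal I.
  split=> [|a b [T hT] [T' hT']|c a [T hT]].
  - by exists [::] => u _; rewrite meval0 eqxx.
  - exists (T ++ T') => u zu; rewrite mevalD => hu.
    have [a0|a0] := eqVneq a.@[u] 0.
      have [|w [c [wT e]]] := hT' u zu; first by rewrite a0 add0r in hu.
      by exists w, c; rewrite mem_cat wT orbT.
    by have [w [c [wT e]]] := hT u zu a0; exists w, c; rewrite mem_cat wT.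
  - exists T => u zu; rewrite mevalM mulf_eq0 negb_or => /andP [_].
    exact: hT.
have gI : graded I.
  split=> // d p [T hT]; exists T => u zu hu.
  have [|c c0 hc] := @restrict_line_neq0 u p.
    by apply: contraNneq hu => e; rewrite -coef_restrict_line e coef0.
  have [|w [c' [wT e]]] := hT _ _ hc; first exact: zeros_scale zu _.
  exists w, (c^-1 * c'); split=> // i.
  by rewrite -mulrA -e mulKf.
have pI : has_powers I.
  apply: contrapT => /(nullstellensatz gI) [v v0 hv].
  have zv : zeros s v.
    move=> p ps; apply: hv; exists [::] => u zu.
    by rewrite zu // eqxx.
  have [a va ha] := isolated_zero v0.
  case/eqP: va; apply/polyP => d; rewrite coef_restrict_line coef0.
  apply: hv; apply: (gI.2); exists [:: [ffun i => v i]] => u zu /(ha u zu) [c e].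
  exists [ffun i => v i], c; rewrite mem_head; split=> // i.
  by rewrite ffunE.
have /choice [t /choice [T hT]] := pI.
have [w|l hl hlp] :=
  @linform_avoiding K k [seq w : {ffun 'I_k -> K} <- flatten (codom T) | [exists i, w i != 0]].
  by rewrite mem_filter => /andP [/existsP].
exists l => // u /zeros_cons [lu zu] i; apply: contrapT => /eqP ui.
have [|w [c [wT e]]] := hT i u zu.
  by rewrite rmorphXn /= mevalXU expf_neq0.
have wc : c * w i != 0 by rewrite -e.
have : l.@[w] != 0.
  apply: hlp; rewrite mem_filter; apply/andP; split.
    apply/existsP; exists i; apply: contraNneq wc => ->; by rewrite mulr0.
  by apply/flattenP; exists (T i) => //; apply: codom_f.
case/negP; move/eqP: lu; rewrite (meval_scale hl e) expr1 mulf_eq0.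
case/orP => // /eqP c0; move: wc; by rewrite c0 mul0r eqxx.
Qed.

End ChainCondition.

End Lines.

(** * The choice of the complete intersection *)

(** The families of N points of A are a means to bound A that also rules out the
infinite case. *)
Lemma card_le_finite_families (T : Type) (A : set T) n :
  (forall N (g : 'I_N -> T), injective g -> (forall i, A (g i)) -> (N <= n)%N) ->
  (A #<= `I_n)%card.
Proof.
move=> h.
have hN N : (`I_N #<= A)%card -> (N <= n)%N.
  move=> /card_leP [f].
  pose g (i : 'I_N) : T := set_val (f (ordII i)).
  apply: (h N g) => [i j /val_inj|i]; last exact: set_valP.
  by move=> /(@inj _ _ _ f) eq_ij; apply/(can_inj ordIIK)/eq_ij; rewrite inE.
have [/finite_setP [N eqA]|/infiniteP infA] := pselect (finite_set A).
  rewrite (card_le_eql eqA) card_le_II; apply: hN.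
  by move: eqA; rewrite card_eq_le => /andP [].
suff : (n.+1 <= n)%N by rewrite ltnn.
by apply: hN; apply: card_le_trans infA; apply: subset_card_le.
Qed.

Section Dimension.
Variables (K : closedFieldType) (k : nat).
Local Notation R := {mpoly K[k]}.
Implicit Types (s t L : seq R).

Lemma dim_le_sub s t r : {subset s <= t} -> dim_le s r -> dim_le t r.
Proof.
move=> sub [L [sL hL tL]]; exists L; split=> //.
by apply: trivzero_sub tL => p; rewrite !mem_cat => /orP [/sub ->|->]; rewrite ?orbT.
Qed.

Lemma dim_le_nil r : dim_le ([::] : seq R) r -> (k <= r)%N.
Proof.
move=> [L [sL hL tL]]; rewrite leqNgt; apply/negP => lt_rk.
(* Padded with zero forms, L would be a system of k forms, and 0 would not be
   a zero divisor. *)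
have [] : regseq [set 0] ([::] ++ (0 : R) :: nseq (k - r.+1) 0 ++ L).
  apply: regular_system => //.
  - move=> p; rewrite inE mem_cat => /or3P [/eqP ->|/nseqP [-> _]|/hL //];
      exact: rpred0.
  - by rewrite /= size_cat size_nseq sL; lia.
  - by apply: trivzero_sub tL => p pL; rewrite !(inE, mem_cat) pL !orbT.
by move=> /(_ 1) /= h _; have /eqP := h (mulr0 _); rewrite oner_eq0.
Qed.

End Dimension.

Section InitialForms.
Variables (K : closedFieldType) (k : nat) (f : nat -> {mpoly K[k]}).

Definition initial_forms r : seq {mpoly K[k]} := [seq f i | i <- iota 1 r].

Lemma mem_initial_forms r p :
  reflect (exists2 i, (1 <= i <= r)%N & p = f i) (p \in initial_forms r).
Proof.
apply: (iffP mapP) => -[i hi ->]; exists i => //.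
  by move: hi; rewrite mem_iota add1n ltnS.
by rewrite mem_iota add1n ltnS.
Qed.

Lemma initial_forms_sub r r' : (r <= r')%N ->
  {subset initial_forms r <= initial_forms r'}.
Proof.
move=> le_r p /mem_initial_forms [i /andP [i1 ir] ->]; apply/mem_initial_forms.
by exists i; rewrite ?i1 ?(leq_trans ir).
Qed.

Lemma mem_initial_formsS r p :
  (p \in initial_forms r.+1) = (p \in f r.+1 :: initial_forms r).
Proof.
rewrite [RHS]in_cons; apply/mem_initial_forms/orP.
  move=> [i /andP [i1]]; rewrite leq_eqVlt => /predU1P [->|ir] ->.
    by left.
  by right; apply/mem_initial_forms; exists i; rewrite ?i1.
move=> [/eqP ->|/mem_initial_forms [i /andP [i1 ir] ->]].
  by exists r.+1; rewrite ?leqnn.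
by exists i; rewrite ?i1 ?(leq_trans ir).
Qed.

Lemma initial_forms_behead r :
  {subset initial_forms r.+1 <= f r.+1 :: initial_forms r}.
Proof. by move=> p h; apply: etrans (esym (mem_initial_formsS r p)) h. Qed.

Lemma initial_forms_cons r :
  {subset f r.+1 :: initial_forms r <= initial_forms r.+1}.
Proof. by move=> p h; apply: etrans (mem_initial_formsS r p) h. Qed.

End InitialForms.

Section Bound.
Variables (K : closedFieldType) (n m : nat).
Local Notation k := n.+1.
Local Notation R := {mpoly K[k]}.
Variables (f : nat -> R) (d : nat -> nat).
Hypothesis hhomog : forall i : nat, (1 <= i <= m)%N -> f i \is (d i).-homog.
Hypothesis hd0 : forall i, (1 <= i <= m)%N -> (0 < d i)%N.
Hypothesis hmono : forall i j : nat, (1 <= i)%N -> (i <= j)%N -> (j <= m)%N ->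
  (d i <= d j)%N.

Lemma initial_posforms r : (r <= m)%N -> posforms (initial_forms f r).
Proof.
move=> le_rm p /mem_initial_forms [i /andP [i1 ir] ->].
have hi : (1 <= i <= m)%N by rewrite i1 (leq_trans ir).
by exists (d i); [apply: hd0 | apply: hhomog].
Qed.

Lemma dim_le_initial_forms j : dim_le (initial_forms f m) 1 -> (j <= m)%N ->
  dim_le (initial_forms f (m - j)) j.+1.
Proof.
move=> h1; elim: j => [|j IH] lt_jm; first by rewrite subn0.
have := IH (ltnW lt_jm); rewrite -(ltn_predK (_ : 0 < m - j)%N) ?subn_gt0 //.
rewrite -subnS => hj; apply: (@dim_le_behead _ _ (f (m - j.+1).+1)).
  move=> p /initial_forms_cons; apply: initial_posforms.
  by rewrite -subSn // subSS leq_subr.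
exact: dim_le_sub (@initial_forms_behead _ _ _ _) hj.
Qed.

Lemma dim_le_regular s j : (s <= m)%N -> regular_sequence f s -> (j <= s)%N ->
  (j <= k)%N -> dim_le (initial_forms f j) (k - j).
Proof.
move=> le_sm [reg _]; elim: j => [|j IH] le_js le_jk.
  exists [seq 'X_i | i <- enum 'I_k]; split.
  - by rewrite size_map size_enum_ord subn0.
  - by move=> p /mapP [i _ ->]; have := dhomogXU_exp K i 1.
  - move=> v zv i; rewrite -(mevalXU v i); apply: zv.
    by apply/mapP; exists i; rewrite ?mem_enum.
have lt_jm : (j < m)%N by apply: leq_trans le_sm.
apply: dim_le_sub (@initial_forms_cons _ _ f j) _; apply: dim_le_drop.
- exact/initial_posforms/ltnW.
- by exists (d j.+1); [apply: hd0 | apply: hhomog].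
- by rewrite -subSn // ; apply: IH; apply: ltnW.
- move=> g; rewrite /initial_forms -ideal_genE mulrC.
  by apply: (reg j.+1).
Qed.

(** Once G has j forms, the first m + j + 2 - k equations have a smaller dimension
than G, so [dim_le_next] finds a further form in their ideal, of the degree of
the last of them. *)
Lemma complete_intersection s j : (s <= m)%N -> regular_sequence f s ->
  dim_le (initial_forms f m) 1 -> (n <= m)%N -> (s <= j)%N -> (j <= n)%N ->
  exists (G : seq R) (ds : seq nat),
    [/\ size G = j, posforms G, all2 (fun p e => p \is e.-homog) G ds,
        dim_le G (k - j) & (forall v, zeros (initial_forms f m) v -> zeros G v)] /\
    (\prod_(e <- ds) e =
     \prod_(1 <= i < s.+1) d i * \prod_(m + s + 2 - k <= i < m + j + 2 - k) d i)%N.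
Proof.
move=> le_sm reg h1 le_nm le_sj; rewrite -(subnKC le_sj).
elim: (j - s)%N => [|i IH] le_jn.
  rewrite addn0 in le_jn *.
  exists (initial_forms f s), [seq d i | i <- iota 1 s]; split; last first.
    by rewrite big_map [X in (_ * X)%N]big_geq ?muln1 // /index_iota subn1.
  split=> //.
  - by rewrite size_map size_iota.
  - exact: initial_posforms.
  - have : all (fun i => (1 <= i <= m)%N) (iota 1 s).
      by apply/allP => i; rewrite mem_iota; lia.
    rewrite /initial_forms; elim: (iota 1 s) => //= i l IHl /andP [hi /IHl ->].
    by rewrite hhomog.
  - by apply: (dim_le_regular (s := s)) => //; apply: leqW.
  - by move=> v zv p /(initial_forms_sub le_sm) /zv.
have [G [ds [[sG pG hG dG zG] eds]]] := IH (ltnW (ltac:(lia) : (s + i < n)%N)).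
(* The least index for which the bound 1 + m - M on the dimension of the first
   M equations is below the one of G. *)
pose M := (m + (s + i) + 2 - k)%N.
have M1 : (1 <= M)%N by rewrite /M; lia.
have Mm : (M <= m)%N by rewrite /M; lia.
have dM : dim_le (initial_forms f M) (n - (s + i)).
  have := dim_le_initial_forms h1 (leq_subr M m).
  by rewrite subKn // (_ : (m - M).+1 = n - (s + i))%N //; rewrite /M; lia.
have [||g [hg Ig dgG]] :=
  @dim_le_next K k G (initial_forms f M) (d M) (n - (s + i)) pG _ _ dM.
- move=> p /mem_initial_forms [u /andP [u1 uM] ->]; exists (d u).
  have hu : (1 <= u <= m)%N by rewrite u1 (leq_trans uM).
  by split; [apply: hd0 | apply: hmono | apply: hhomog].
- by rewrite -subSn // ; lia.
exists (g :: G), (d M :: ds); split; last first.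
  rewrite big_cons eds.
  have -> : (m + (s + i.+1) + 2 - k = M.+1)%N by rewrite /M; lia.
  rewrite [X in _ = (_ * X)%N]big_nat_recr /=; last by rewrite /M; lia.
  by rewrite -/M mulnCA (mulnC (d M)).
split=> //=.
- by rewrite sG addnS.
- by apply/posforms_cons; split=> //; exists (d M) => //; apply: hd0; rewrite M1.
- by rewrite hg.
- by rewrite addnS subSS.
- move=> v zv; apply/zeros_cons; split; last exact: zG.
  by apply: ideal_of_zeros Ig => p /(initial_forms_sub Mm) /zv.
Qed.

Lemma regular_bound s N (v : 'I_N -> 'I_k -> K) : (s <= m)%N ->
  regular_sequence f s -> dim_le (initial_forms f m) 1 ->
  (forall i, exists j, v i j != 0) -> (forall i j, i != j -> nonprop (v i) (v j)) ->
  (forall i, zeros (initial_forms f m) (v i)) ->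
  (N <= \prod_(1 <= i < s.+1) d i * \prod_(m + s + 2 - k <= i < m.+1) d i)%N.
Proof.
move=> le_sm reg h1 v0 npv zv.
(* k regular forms vanish together at the origin only. *)
have [le_ks|lt_sk] := leqP k s.
  have [L [/eqP]] := dim_le_regular le_sm reg le_ks (leqnn k).
  rewrite subnn size_eq0 => /eqP -> _; rewrite cats0 => t0.
  case: N v v0 npv zv => // N v v0 _ zv; have [j] := v0 ord0.
  rewrite t0 ?eqxx //; move=> p /(initial_forms_sub (leq_trans le_ks le_sm)).
  exact: zv.
have le_nm : (n <= m)%N.
  have := dim_le_initial_forms h1 (leqnn m); rewrite subnn => /dim_le_nil.
  by rewrite ltnS.
have [G [ds [[sG pG hG [L [sL hL tL]] zG] eds]]] :=
  complete_intersection le_sm reg h1 le_nm lt_sk (leqnn n).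
have e : (m + n + 2 - k = m.+1)%N by lia.
rewrite -[in X in (_ * X)%N]e -eds.
case: L sL hL tL => [|l [|? ?]]; rewrite ?subSnn // => _ hL tL.
apply: (bezout_points sG pG hG (l := l) _ _ v0 npv) => [||i].
- by apply: hL; rewrite mem_head.
- by rewrite -cats1.
- exact: zG.
Qed.

End Bound.

Lemma krull_linform (K : closedFieldType) (k m : nat) (f : nat -> {mpoly K[k]}) :
  posforms (initial_forms f m) -> has_proj_dim m f 0 ->
  dim_le (initial_forms f m) 1.
Proof.
move=> hp [J [eJ hJ]].
have [P0 P1 P2 p0 p1 p2 s0 s01 s12|l hl tl] := chain_condition_linform hp.
  apply: (krull_dim1_no_chain hJ p0 p1 p2 _ s01 s12) => a aJ; apply: s0.
  by rewrite -ideal_genE -eJ.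
exists [:: l]; split=> //; first by move=> p; rewrite inE => /eqP ->.
by apply: trivzero_sub tl => p; rewrite !(inE, mem_cat) orbC.
Qed.

Lemma regular_sequence1 (K : closedFieldType) k (f : nat -> {mpoly K[k]}) e :
  (0 < e)%N -> f 1%N \is e.-homog -> f 1%N != 0 -> regular_sequence f 1.
Proof.
move=> e0 h1 f0; split=> [i|].
  case: i => [|[|//]] // _ g; rewrite /= !ideal_genE /= => /eqP.
  by rewrite mulf_eq0 (negbTE f0) => /eqP.
rewrite ideal_genE => /(ideal_of_zeros (v := fun=> 0)) h.
have /eqP : (1 : {mpoly K[k]}).@[fun=> 0] = 0.
  apply: h => p; rewrite inE => /eqP ->.
  rewrite (@meval_scale _ _ _ _ 0 (fun=> 0) _ h1) => [|i]; last by rewrite mul0r.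
  by rewrite expr0n gtn_eqF // mul0r.
by rewrite meval1 oner_eq0.
Qed.

(** Each projective point is represented by a nonzero vector on its line. *)
Lemma proj_zeros_card (K : closedFieldType) k m (f : nat -> {mpoly K[k]}) c :
  (forall N (v : 'I_N -> 'I_k -> K), (forall i, exists j, v i j != 0) ->
     (forall i j, i != j -> ~ exists c, forall l, v i l = c * v j l) ->
     (forall i, zeros (initial_forms f m) (v i)) -> (N <= c)%N) ->
  (proj_zeros m f #<= `I_c)%card.
Proof.
move=> h; apply: card_le_finite_families => N g inj_g zg.
pose v i := vpick (sval (g i)).
have dim1 i : \dim (sval (g i)) = 1%N by apply/eqP; exact: (svalP (g i)).
have v0 i : v i != 0.
  by rewrite /v vpick0 -dimv_eq0 dim1.
have line i : sval (g i) = <[v i]>%VS.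
  apply/eqP; rewrite eq_sym eqEdim -memvE memv_pick dim_vline v0 /=.
  by rewrite dim1.
apply: (h N (fun i => v i ord0)) => [i|i j ne [x hx]|i p].
- apply: contrapT => nv; have /eqP := v0 i; apply; apply/rowP => j.
  by rewrite mxE; apply: contrapT => /eqP vj; apply: nv; exists j.
- case/eqP: ne; apply: inj_g; apply: val_inj; rewrite /= !line.
  have ev : v i = x *: v j by apply/rowP => l; rewrite mxE hx.
  apply/eqP; rewrite eqEdim !dim_vline !v0 leqnn andbT -memvE ev.
  by apply/memvZ/memv_line.
- move=> /mem_initial_forms [u hu ->]; apply: zg => //.
  exact: memv_pick.
Qed.

Theorem corollary2p2 (K : closedFieldType) (k m : nat)
    (f : nat -> {mpoly K[k]}) (d : nat -> nat)
    (hk : (1 <= k)%N) (hm : (1 <= m)%N)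
    (hhomog : forall i : nat, (1 <= i <= m)%N -> f i \is (d i).-homog)
    (hdeg : forall i : nat, (1 <= i <= m)%N -> msize (f i) = (d i).+1)
    (hd1 : (0 < d 1)%N)
    (hmono : forall i j : nat, (1 <= i)%N -> (i <= j)%N -> (j <= m)%N ->
               (d i <= d j)%N)
    (hdim : has_proj_dim m f 0) :
  (proj_zeros m f #<= `I_(d 1 * \prod_(m + 3 - k <= i < m.+1) d i)%N)%card
  /\
  (forall s : nat, (s <= m)%N -> regular_sequence f s ->
     (proj_zeros m f #<=
        `I_(\prod_(1 <= i < s.+1) d i
            * \prod_(m + s + 2 - k <= i < m.+1) d i)%N)%card).
Proof.
have hd0 i : (1 <= i <= m)%N -> (0 < d i)%N.
  by move=> /andP [i1 im]; apply: leq_trans hd1 (hmono _ _ _ i1 im).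
have bound s : (s <= m)%N -> regular_sequence f s ->
    (proj_zeros m f #<= `I_(\prod_(1 <= i < s.+1) d i
            * \prod_(m + s + 2 - k <= i < m.+1) d i)%N)%card.
  move=> le_sm reg; apply: proj_zeros_card => N v v0 npv zv.
  case: k hk f hhomog hdeg hdim reg v v0 npv zv => // n _ {}f hf _ hdim' reg v v0 npv zv.
  apply: (regular_bound hf hd0 hmono le_sm reg _ v0 npv zv).
  exact: krull_linform (initial_posforms hf hd0 (leqnn m)) hdim'.
split=> //.
have h11 : (1 <= 1 <= m)%N by rewrite hm.
have reg1 : regular_sequence f 1.
  apply: (regular_sequence1 hd1 (hhomog 1%N h11)).
  by rewrite -msize_poly_eq0 hdeg.
by have := bound 1%N hm reg1; rewrite big_nat1 -addnA.
Qed.
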